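(* Let $q\in\mathbb R$, $q\neq0$, and let $\mathcal R=R\,U_q(4)$ be the right ideal of $U_q(4)$ generated by $$R=\mathrm{Span}\{t_{13},t_{31},t_{14},t_{41},t_{24},t_{42},t_{23},t_{32},\ t_{11}-t_{44},\ t_{12}+t_{43},\ t_{21}+t_{34},\ t_{22}-t_{33},\ t_{11}t_{22}-q\,t_{12}t_{21}-1\}.$$ Then, as a $\tau$-coalgebra, $U_q(4)/\mathcal R$ is isomorphic to $SU_q(2)$.
   Context: $U_q(4)$ is the complex Hopf $*$-algebra generated by $\{t_{ij}\}_{i,j=1}^4$ and $D_q^{-1}$ with relations $t_{ik}t_{jk}=q\,t_{jk}t_{ik}$ and $t_{ki}t_{kj}=q\,t_{kj}t_{ki}$ for $i<j$; $t_{i\ell}t_{jk}=t_{jk}t_{i\ell}$ and $t_{ik}t_{j\ell}-t_{j\ell}t_{ik}=(q-q^{-1})t_{jk}t_{i\ell}$ for $i<j$, $k<\ell$; $D_qD_q^{-1}=D_q^{-1}D_q=1$, where $D_q=\sum_{\sigma\in P_4}(-q)^{\ell(\sigma)}t_{\sigma(1)1}\cdots t_{\sigma(4)4}$ is the (central) quantum determinant, $P_4$ is the group of permutations of $4$ elements and $\ell(\sigma)$ is the length. The coproduct and counit are $\Delta(t_{ij})=\sum_kt_{ik}\otimes t_{kj}$, $\Delta(D_q)=D_q\otimes D_q$, $\epsilon(t_{ij})=\delta_{ij}$, $\epsilon(D_q)=1$; $S$ is the antipode, and the $*$-structure is $t_{ij}^*=S(t_{ji})$, $D_q^*=D_q^{-1}$.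 $SU_q(2)$ is the Hopf $*$-algebra generated by $\{u_{ij}\}_{i,j=1}^2$ with the same type of quadratic relations (indices in $\{1,2\}$), with $u_{11}u_{22}-q\,u_{12}u_{21}=1$, $\Delta(u_{ij})=\sum_ku_{ik}\otimes u_{kj}$, $\epsilon(u_{ij})=\delta_{ij}$, $u_{ij}^*=S(u_{ji})$. On a Hopf $*$-algebra put $\tau=*\circ S$. The subspace $\mathcal R$ is a $\tau$-invariant right ideal and two-sided coideal, so $U_q(4)/\mathcal R$ inherits a coalgebra structure, a right $U_q(4)$-module structure and an antilinear map $\tau$ (but not in general an algebra structure). A $\tau$-coalgebra is a coalgebra with such an antilinear map $\tau$; an isomorphism of $\tau$-coalgebras is a linear coalgebra isomorphism intertwining the maps $\tau$. *)

(* Defs.v *)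
From HB Require Import structures.
From mathcomp Require Import all_boot all_order all_algebra.
From mathcomp Require Import generic_quotient finmap perm.
From mathcomp Require Import boolp classical_sets reals complex.
From mathcomp.multinomials Require Import monalg.

Set Implicit Arguments.
Unset Strict Implicit.
Unset Printing Implicit Defensive.

Import GRing.Theory Num.Theory.
Local Open Scope classical_set_scope.
Local Open Scope ring_scope.
Local Open Scope quotient_scope.

Section Span.
Context {K : fieldType} {V : lmodType K}.
Implicit Types X : set V.

Definition span X : set V :=
  [set x | exists s : seq (K * V),
     (forall p, p \in s -> X p.2) /\ x = \sum_(p <- s) p.1 *: p.2].

Lemma span0 X : span X 0.
Proof. by exists [::]; split=> //; rewrite big_nil. Qed.

Lemma spanD X x y : span X x -> span X y -> span X (x + y).
Proof.
move=> [s [hs ->]] [r [hr ->]]; exists (s ++ r); split; last by rewrite big_cat.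
by move=> p; rewrite mem_cat => /orP[/hs|/hr].
Qed.

Lemma spanZ X a x : span X x -> span X (a *: x).
Proof.
move=> [s [hs ->]]; exists [seq (a * p.1, p.2) | p <- s]; split.
  by move=> p /mapP[r /hs h ->].
rewrite big_map scaler_sumr; apply: eq_bigr => p _ /=; exact: scalerA.
Qed.

Lemma spanN X x : span X x -> span X (- x).
Proof. by move=> h; rewrite -scaleN1r; exact: spanZ. Qed.

Lemma sub_span X x : X x -> span X x.
Proof.
move=> h; exists [:: (1, x)]; rewrite big_seq1 scale1r; split=> // p.
by rewrite inE => /eqP->.
Qed.

End Span.

Section Quotient.
Context {K : fieldType} {V : lmodType K} (X : set V).

Definition quot_rel (x y : V) : bool := `[< span X (x - y) >].

Lemma quot_rel_refl : reflexive quot_rel.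
Proof. by move=> x; apply/asboolP; rewrite subrr; exact: span0. Qed.

Lemma quot_rel_sym : symmetric quot_rel.
Proof.
by move=> x y; apply/asboolP/asboolP => /spanN; rewrite opprB.
Qed.

Lemma quot_rel_trans : transitive quot_rel.
Proof.
move=> y x z /asboolP h1 /asboolP h2; apply/asboolP.
by have := spanD h1 h2; rewrite subrKA.
Qed.

Canonical quot_equiv :=
  EquivRel quot_rel quot_rel_refl quot_rel_sym quot_rel_trans.

(* The quotient space V / span X; it is V / X when X is already a subspace. *)
Definition quot := {eq_quot quot_equiv}.
HB.instance Definition _ := Choice.on quot.
HB.instance Definition _ := EqQuotient.on quot.

Definition quot_pi (x : V) : quot := \pi_quot x.

Lemma quot_piP x y : quot_pi x = quot_pi y <-> span X (x - y).
Proof.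
split=> [/eqmodP h|h]; first exact/asboolP.
by apply/eqmodP/asboolP.
Qed.

Lemma quot_piK (u : quot) : quot_pi (repr u) = u.
Proof. exact: reprK. Qed.

Let qzero : quot := quot_pi 0.
Let qopp (u : quot) : quot := quot_pi (- repr u).
Let qadd (u v : quot) : quot := quot_pi (repr u + repr v).
Let qscale (a : K) (u : quot) : quot := quot_pi (a *: repr u).

Let repr_pi x : span X (repr (quot_pi x) - x).
Proof. by apply/quot_piP; exact: quot_piK. Qed.

Let qoppE x : qopp (quot_pi x) = quot_pi (- x).
Proof. by apply/quot_piP; rewrite -opprD; exact/spanN/repr_pi. Qed.

Let qaddE x y : qadd (quot_pi x) (quot_pi y) = quot_pi (x + y).
Proof.
by apply/quot_piP; rewrite opprD addrACA; apply: spanD; exact: repr_pi.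
Qed.

Let qscaleE a x : qscale a (quot_pi x) = quot_pi (a *: x).
Proof. by apply/quot_piP; rewrite -scalerBr; exact/spanZ/repr_pi. Qed.

Let qaddA : associative qadd.
Proof.
move=> u v w; rewrite -(quot_piK u) -(quot_piK v) -(quot_piK w).
by rewrite !qaddE addrA.
Qed.

Let qaddC : commutative qadd.
Proof. by move=> u v; rewrite /qadd addrC. Qed.

Let qadd0 : left_id qzero qadd.
Proof. by move=> u; rewrite -(quot_piK u) qaddE add0r. Qed.

Let qaddN : left_inverse qzero qopp qadd.
Proof. by move=> u; rewrite -(quot_piK u) qoppE qaddE addNr. Qed.

HB.instance Definition _ := GRing.isZmodule.Build quot qaddA qaddC qadd0 qaddN.

Let qscaleA a b u : qscale a (qscale b u) = qscale (a * b) u.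
Proof. by rewrite -(quot_piK u) !qscaleE scalerA. Qed.

Let qscale1 : left_id 1 qscale.
Proof. by move=> u; rewrite -(quot_piK u) qscaleE scale1r. Qed.

Let qscaleDr : right_distributive qscale +%R.
Proof.
move=> a u v; rewrite -(quot_piK u) -(quot_piK v).
by rewrite [_ + _]qaddE !qscaleE [RHS]qaddE scalerDr.
Qed.

Let qscaleDl u : {morph qscale^~ u : a b / a + b}.
Proof.
by move=> a b; rewrite -(quot_piK u) !qscaleE [RHS]qaddE scalerDl.
Qed.

HB.instance Definition _ :=
  GRing.Zmodule_isLmodule.Build K quot qscaleA qscale1 qscaleDr qscaleDl.

Lemma quot_pi_is_linear : linear quot_pi.
Proof.
move=> a x y; rewrite -qaddE -[in LHS]qscaleE; reflexivity.
Qed.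

HB.instance Definition _ :=
  GRing.isLinear.Build K V quot *:%R quot_pi quot_pi_is_linear.

End Quotient.

Section Tensor.
Context {K : fieldType}.

Inductive bilinear_rel (V W : lmodType K) : {malg K[(V * W)%type]} -> Prop :=
| BilinDl v v' w :
    bilinear_rel (<< (v + v', w) >> - << (v, w) >> - << (v', w) >>)
| BilinDr v w w' :
    bilinear_rel (<< (v, w + w') >> - << (v, w) >> - << (v, w') >>)
| BilinZl a v w : bilinear_rel (<< (a *: v, w) >> - a *: << (v, w) >>)
| BilinZr a v w : bilinear_rel (<< (v, a *: w) >> - a *: << (v, w) >>).

Definition tensor (V W : lmodType K) : lmodType K :=
  quot (@bilinear_rel V W).

Definition tens {V W : lmodType K} (v : V) (w : W) : tensor V W :=
  quot_pi (@bilinear_rel V W) << (v, w) >>.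

Definition semibilinear (s : K -> K) {V W Y : lmodType K} (f : V -> W -> Y) :=
  (forall a v v' w, f (a *: v + v') w = s a *: f v w + f v' w) /\
  (forall a v w w', f v (a *: w + w') = s a *: f v w + f v w').

(* The s-semilinear map on the tensor product induced by a semibilinear map f;
   it is evaluated on an arbitrary representative of z, and meaningful only
   for semibilinear f (lemmas tlift_tens and tlift_semilinear). *)
Definition tlift (s : K -> K) {V W Y : lmodType K} (f : V -> W -> Y)
    (z : tensor V W) : Y :=
  let g : {malg K[(V * W)%type]} := repr z in
  \sum_(k <- msupp g) s g@_k *: f k.1 k.2.

Section TliftTheory.
Context (s : {rmorphism K -> K}) (V W Y : lmodType K) (f : V -> W -> Y).

Let ev (g : {malg K[(V * W)%type]}) : Y :=
  \sum_(k <- msupp g) s g@_k *: f k.1 k.2.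

Let evEw (d : {fset (V * W)%type}) g : (msupp g `<=` d)%fset ->
  ev g = \sum_(k <- d) s g@_k *: f k.1 k.2.
Proof.
move=> le; rewrite /ev (big_fset_incl _ le) // => k _ /mcoeff_outdom ->.
by rewrite rmorph0 scale0r.
Qed.

Let evD g1 g2 : ev (g1 + g2) = ev g1 + ev g2.
Proof.
pose d := (msupp g1 `|` msupp g2)%fset.
rewrite !(@evEw d) ?fsubsetUl ?fsubsetUr ?msuppD_le // -big_split /=.
by apply: eq_bigr => k _; rewrite mcoeffD rmorphD scalerDl.
Qed.

Let evZ a g : ev (a *: g) = s a *: ev g.
Proof.
rewrite (@evEw (msupp g)) ?msuppZ_le // /ev scaler_sumr.
by apply: eq_bigr => k _; rewrite mcoeffZ rmorphM scalerA.
Qed.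

Let evU v w : ev << (v, w) >> = f v w.
Proof.
by rewrite (evEw msuppU_le) big_seq_fset1 mcoeffUU rmorph1 scale1r.
Qed.

Let evB g1 g2 : ev (g1 - g2) = ev g1 - ev g2.
Proof. by apply: (addIr (ev g2)); rewrite -evD !subrK. Qed.

Hypothesis bil : semibilinear s f.

Let ev_span g : span (@bilinear_rel V W) g -> ev g = 0.
Proof.
case: bil => bl br [r [hr ->]].
have ev0 : ev 0 = 0 by rewrite -(subrr 0) evB subrr.
elim: r hr => [|p r IH] hr; rewrite ?big_nil // big_cons evD evZ IH; last first.
  by move=> p' h; apply: hr; rewrite inE h orbT.
have fl0 v w w' : f v (w + w') = f v w + f v w'.
  by have := br 1 v w w'; rewrite rmorph1 !scale1r.
have fr0 v v' w : f (v + v') w = f v w + f v' w.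
  by have := bl 1 v v' w; rewrite rmorph1 !scale1r.
have fZl a v w : f (a *: v) w = s a *: f v w.
  have f0 : f 0 w = 0 by apply: (addrI (f 0 w)); rewrite -fr0 !addr0.
  by have := bl a v 0 w; rewrite addr0 f0 addr0.
have fZr a v w : f v (a *: w) = s a *: f v w.
  have f0 : f v 0 = 0 by apply: (addrI (f v 0)); rewrite -fl0 !addr0.
  by have := br a v w 0; rewrite addr0 f0 addr0.
have := hr p; rewrite mem_head => /(_ isT).
case=> [v v' w|v w w'|a v w|a v w].
- by rewrite 2!evB !evU fr0 addrAC addrK subrr scaler0 addr0.
- by rewrite 2!evB !evU fl0 addrAC addrK subrr scaler0 addr0.
- by rewrite evB evZ !evU fZl subrr scaler0 addr0.
- by rewrite evB evZ !evU fZr subrr scaler0 addr0.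
Qed.

Let evR (z : tensor V W) g : quot_pi _ g = z -> tlift s f z = ev g.
Proof.
move=> <-; apply/eqP; rewrite -subr_eq0; apply/eqP.
rewrite -[tlift _ _ _]/(ev _) -evB; apply: ev_span.
by apply/quot_piP; exact: quot_piK.
Qed.

Lemma tlift_tens v w : tlift s f (tens v w) = f v w.
Proof. by rewrite (evR (erefl _)) evU. Qed.

Lemma tlift_semilinear a (x y : tensor V W) :
  tlift s f (a *: x + y) = s a *: tlift s f x + tlift s f y.
Proof.
rewrite -[x in LHS]quot_piK -[y in LHS]quot_piK -linearP (evR (erefl _)).
by rewrite evD evZ -!(evR (quot_piK _)).
Qed.

End TliftTheory.

Lemma tens_bilinear (V W : lmodType K) : semibilinear idfun (@tens V W).
Proof.
have Dl v v' w : tens (v + v') w = tens v w + tens v' w :> tensor V W.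
  rewrite -[RHS]linearD; apply/quot_piP; rewrite opprD addrA.
  exact/sub_span/BilinDl.
have Dr v w w' : tens v (w + w') = tens v w + tens v w' :> tensor V W.
  rewrite -[RHS]linearD; apply/quot_piP; rewrite opprD addrA.
  exact/sub_span/BilinDr.
have Zl a v w : tens (a *: v) w = a *: tens v w :> tensor V W.
  by rewrite -[RHS]linearZ; apply/quot_piP; exact/sub_span/BilinZl.
have Zr a v w : tens v (a *: w) = a *: tens v w :> tensor V W.
  by rewrite -[RHS]linearZ; apply/quot_piP; exact/sub_span/BilinZr.
by split=> *; rewrite ?Dl ?Dr ?Zl ?Zr.
Qed.

Notation lin_tlift := (tlift idfun).

Definition tens_assoc {V W Y : lmodType K} (z : tensor (tensor V W) Y) :
    tensor V (tensor W Y) :=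
  lin_tlift (fun x y => lin_tlift (fun v w => tens v (tens w y)) x) z.

Definition tens_map {V W V' W' : lmodType K} (f : V -> V') (g : W -> W')
    (z : tensor V W) : tensor V' W' :=
  lin_tlift (fun v w => tens (f v) (g w)) z.

Definition tens_mul {A : algType K} (x y : tensor A A) : tensor A A :=
  lin_tlift (fun a b => lin_tlift (fun c d => tens (a * c) (b * d)) y) x.

Lemma lin_tlift_tens (V W Y : lmodType K) (f : V -> W -> Y) v w :
  semibilinear idfun f -> lin_tlift f (tens v w) = f v w.
Proof. by move=> h; exact: (@tlift_tens idfun). Qed.

Lemma lin_tlift_linear (V W Y : lmodType K) (f : V -> W -> Y) :
  semibilinear idfun f -> linear (lin_tlift f).
Proof. by move=> h a x y; exact: (@tlift_semilinear idfun). Qed.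

Lemma tens_map_tens (V W V' W' : lmodType K)
    (f : {linear V -> V'}) (g : {linear W -> W'}) v w :
  tens_map f g (tens v w) = tens (f v) (g w).
Proof.
have [bl br] := @tens_bilinear V' W'.
apply: (lin_tlift_tens (f := fun v w => tens (f v) (g w))).
by split=> *; rewrite linearP ?bl ?br.
Qed.

Lemma tens_assoc_tens (V W Y : lmodType K) (v : V) (w : W) (y : Y) :
  tens_assoc (tens (tens v w) y) = tens v (tens w y).
Proof.
have [bl br] := @tens_bilinear V (tensor W Y).
have [bl' br'] := @tens_bilinear W Y.
pose f (y' : Y) (v' : V) (w' : W) := tens v' (tens w' y').
have fb y' : semibilinear idfun (f y').
  by split=> *; rewrite /f ?bl ?bl' ?br.
rewrite /tens_assoc (lin_tlift_tens (f := fun x y => lin_tlift (f y) x)).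
  exact: (lin_tlift_tens _ _ (fb y)).
split=> [a x x' y'|a x y1 y2]; first exact: lin_tlift_linear.
rewrite /tlift scaler_sumr -big_split /=; apply: eq_bigr => k _.
by rewrite /f br' br scalerDr !scalerA mulrC.
Qed.

Lemma tens_mul_tens (A : algType K) (a b c d : A) :
  tens_mul (tens a b) (tens c d) = tens (a * c) (b * d).
Proof.
have [bl br] := @tens_bilinear A A.
pose f (a b c d : A) : tensor A A := tens (a * c) (b * d).
have fb a' b' : semibilinear idfun (f a' b').
  by split=> *; rewrite /f mulrDr -scalerAr ?bl ?br.
rewrite /tens_mul (lin_tlift_tens (f := fun a b => lin_tlift (f a b) _)).
  exact: (lin_tlift_tens _ _ (fb a b)).
split=> [e x x' y|e x y y']; rewrite /tlift scaler_sumr -big_split /=;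
  apply: eq_bigr => k _; rewrite /f mulrDl -scalerAl ?bl ?br scalerDr !scalerA;
  by rewrite mulrC.
Qed.

End Tensor.

Notation lin_tlift := (tlift idfun).

Section TauCoalgebra.
Context {C : numClosedFieldType}.

Definition antilinear {V W : lmodType C} (f : V -> W) :=
  forall a x y, f (a *: x + y) = a^* *: f x + f y.

Record coalgebra (V : lmodType C) := Coalgebra {
  comul : {linear V -> tensor V V};
  counit : {scalar V};
  comulA : forall x,
    tens_assoc (tens_map comul idfun (comul x)) = tens_map idfun comul (comul x);
  comul_counitl : forall x, lin_tlift (fun a b => counit a *: b) (comul x) = x;
  comul_counitr : forall x, lin_tlift (fun a b => counit b *: a) (comul x) = x
}.

Record tau_coalgebra (V : lmodType C) := TauCoalgebra {
  tc_coalg :> coalgebra V;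
  tau : V -> V;
  tau_antilinear : antilinear tau
}.

Definition tau_coalg_morphism {V W : lmodType C}
    (cV : tau_coalgebra V) (cW : tau_coalgebra W) (f : {linear V -> W}) : Prop :=
  [/\ forall x, comul cW (f x) = tens_map f f (comul cV x),
      forall x, counit cW (f x) = counit cV x
    & forall x, f (tau cV x) = tau cW (f x)].

Definition tau_coalg_iso {V W : lmodType C}
    (cV : tau_coalgebra V) (cW : tau_coalgebra W) : Prop :=
  exists f : {linear V -> W}, bijective f /\ tau_coalg_morphism cV cW f.

End TauCoalgebra.

Section HopfStar.
Context {C : numClosedFieldType}.

Record hopf_star (A : algType C) := HopfStar {
  hcoalg :> coalgebra A;
  hcomulM : forall a b,
    comul hcoalg (a * b) = tens_mul (comul hcoalg a) (comul hcoalg b);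
  hcomul1 : comul hcoalg 1 = tens 1 1;
  hcounitM : forall a b,
    counit hcoalg (a * b) = counit hcoalg a * counit hcoalg b;
  hcounit1 : counit hcoalg 1 = 1;
  antipode : {linear A -> A};
  antipodel : forall a,
    lin_tlift (fun x y => antipode x * y) (comul hcoalg a)
      = (counit hcoalg a)%:A;
  antipoder : forall a,
    lin_tlift (fun x y => x * antipode y) (comul hcoalg a)
      = (counit hcoalg a)%:A;
  star : A -> A;
  star_antilinear : antilinear star;
  starM : forall a b, star (a * b) = star b * star a;
  starK : involutive star;
  (* the *-structure of the tensor square is (x (x) y)^* = x^* (x) y^* *)
  star_comul : forall a,
    comul hcoalg (star a)
      = tlift Num.conj (fun x y => tens (star x) (star y)) (comul hcoalg a);
  star_counit : forall a, counit hcoalg (star a) = (counit hcoalg a)^*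
}.

Lemma star_antipode_antilinear (A : algType C) (H : hopf_star A) :
  antilinear (star H \o antipode H).
Proof. by move=> a x y /=; rewrite linearP star_antilinear. Qed.

Definition hopf_tau (A : algType C) (H : hopf_star A) : tau_coalgebra A :=
  TauCoalgebra H (star_antipode_antilinear H).

End HopfStar.

Section Presentation.
Context {K : fieldType} {I : choiceType}.

(* {malg K[{fmonom I}]} is the free associative algebra on I. *)
Definition free_gen (i : I) : {malg K[{fmonom I}]} := << fmu i >>.

Definition free_eval {A : algType K} (g : I -> A) (p : {malg K[{fmonom I}]}) : A :=
  \sum_(m <- msupp p) p@_m *: \prod_(i <- (m : seq I)) g i.

Definition two_sided_ideal {A : lalgType K} (X : set A) : set A :=
  span [set x | exists a r b, X r /\ x = a * r * b].

(* A is the unital algebra generated by the g i subject to the relations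
   r = 0 for r in X. *)
Definition presented_by {A : algType K} (g : I -> A)
    (X : set {malg K[{fmonom I}]}) : Prop :=
  (forall a, exists p, free_eval g p = a) /\
  (forall p, free_eval g p = 0 <-> two_sided_ideal X p).

End Presentation.

Section QuantumGroups.
Context {C : numClosedFieldType} (q : C).

(* The quadratic relations, each written as (left side) - (right side). *)
Inductive qmatrix_rel (n : nat) (A : lalgType C) (t : 'I_n -> 'I_n -> A) :
    A -> Prop :=
| QrelCol (i j k : 'I_n) : (i < j)%N ->
    qmatrix_rel t (t i k * t j k - q *: (t j k * t i k))
| QrelRow (i j k : 'I_n) : (i < j)%N ->
    qmatrix_rel t (t k i * t k j - q *: (t k j * t k i))
| QrelComm (i j k l : 'I_n) : (i < j)%N -> (k < l)%N ->
    qmatrix_rel t (t i l * t j k - t j k * t i l)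
| QrelCross (i j k l : 'I_n) : (i < j)%N -> (k < l)%N ->
    qmatrix_rel t (t i k * t j l - t j l * t i k
                   - (q - q^-1) *: (t j k * t i l)).

(* The Coxeter length of a permutation, as its number of inversions. *)
Definition perm_length (n : nat) (s : 'S_n) : nat :=
  #|[pred p : 'I_n * 'I_n | (p.1 < p.2)%N && (s p.2 < s p.1)%N]|.

Definition qdet (n : nat) (A : lalgType C) (t : 'I_n -> 'I_n -> A) : A :=
  \sum_(s : 'S_n) (- q) ^+ perm_length s *: \prod_(i < n) t (s i) i.

(* Generators of U_q(n): Some (i, j) stands for t_ij, None for D_q^-1. *)
Definition Uq_gen (n : nat) (A : Type) (t : 'I_n -> 'I_n -> A) (Dinv : A)
    (x : option ('I_n * 'I_n)) : A :=
  if x is Some p then t p.1 p.2 else Dinv.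

Inductive Uq_rel (n : nat) (A : lalgType C) (t : 'I_n -> 'I_n -> A) (Dinv : A) :
    A -> Prop :=
| UqQuad r : qmatrix_rel t r -> Uq_rel t Dinv r
| UqDetr : Uq_rel t Dinv (qdet t * Dinv - 1)
| UqDetl : Uq_rel t Dinv (Dinv * qdet t - 1).

Record is_Uq (n : nat) (U : algType C) (H : hopf_star U)
    (t : 'I_n -> 'I_n -> U) (Dinv : U) : Prop := IsUq {
  Uq_presented : presented_by (Uq_gen t Dinv)
    (Uq_rel (fun i j => free_gen (Some (i, j))) (free_gen None));
  Uq_comul : forall i j, comul H (t i j) = \sum_k tens (t i k) (t k j);
  Uq_comulD : comul H (qdet t) = tens (qdet t) (qdet t);
  Uq_counit : forall i j, counit H (t i j) = (i == j)%:R;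
  Uq_counitD : counit H (qdet t) = 1;
  Uq_star : forall i j, star H (t i j) = antipode H (t j i);
  Uq_starD : star H (qdet t) = Dinv
}.

(* Matrix entries with the indices 1, ..., n of the usual notation. *)
Definition ent (n : nat) (A : Type) (t : 'I_n.+1 -> 'I_n.+1 -> A)
    (i j : nat) : A := t (inord i.-1) (inord j.-1).

Inductive SUq2_rel (A : lalgType C) (u : 'I_2 -> 'I_2 -> A) : A -> Prop :=
| SUq2Quad r : qmatrix_rel u r -> SUq2_rel u r
| SUq2Det :
    SUq2_rel u (ent u 1 1 * ent u 2 2 - q *: (ent u 1 2 * ent u 2 1) - 1).

Record is_SUq2 (A : algType C) (H : hopf_star A) (u : 'I_2 -> 'I_2 -> A) :
    Prop := IsSUq2 {
  SUq2_presented : presented_by (fun p : 'I_2 * 'I_2 => u p.1 p.2)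
    (SUq2_rel (fun i j => free_gen (i, j)));
  SUq2_comul : forall i j, comul H (u i j) = \sum_k tens (u i k) (u k j);
  SUq2_counit : forall i j, counit H (u i j) = (i == j)%:R;
  SUq2_star : forall i j, star H (u i j) = antipode H (u j i)
}.

(* The right ideal X A generated by a set X. *)
Definition right_ideal {A : algType C} (X : set A) : set A :=
  span [set x | exists r a, X r /\ x = r * a].

Definition Rspan {U : algType C} (t : 'I_4 -> 'I_4 -> U) : set U :=
  span [set` [:: ent t 1 3; ent t 3 1; ent t 1 4; ent t 4 1;
                 ent t 2 4; ent t 4 2; ent t 2 3; ent t 3 2;
                 ent t 1 1 - ent t 4 4; ent t 1 2 + ent t 4 3;
                 ent t 2 1 + ent t 3 4; ent t 2 2 - ent t 3 3;
                 ent t 1 1 * ent t 2 2 - q *: (ent t 1 2 * ent t 2 1) - 1 ]].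

End QuantumGroups.

(* Main.v *)
(* SU_q(2) is a right U_q(4)-module: t_ij acts by right multiplication by u_ij
   for i, j <= 2, the lower right block t_33, t_34, t_43, t_44 acts by left
   multiplication by u_22, -u_21, -u_12, u_11 (left and right multiplications
   commute, which matches the relations between the two diagonal blocks), the
   other t_ij act by 0 and D_q^-1 trivially.  The orbit map phi x = 1 x kills R,
   hence the right ideal R U_q(4), and it respects coproducts, counits and tau
   because each generator does.  Conversely every class modulo R U_q(4) has a
   representative b in the subalgebra generated by t_11, t_12, t_21, t_22: past
   such a b an off-block generator moves to the front, where it vanishes, and a
   lower right generator moves to the front, where it is replaced by an upper
   left one.  On such b the map phi is evaluation in SU_q(2), so its kernel is
   generated by the relation t_11 t_22 - q t_12 t_21 = 1, whose left side is
   central there and can also be moved to the front. *)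

From HB Require Import structures.
From mathcomp Require Import all_boot all_order all_algebra.
From mathcomp Require Import boolp classical_sets reals complex.
From mathcomp Require Import generic_quotient finmap perm.
From mathcomp.multinomials Require Import monalg.
Require Import Defs.

Set Implicit Arguments.
Unset Strict Implicit.
Unset Printing Implicit Defensive.

Import GRing.Theory Num.Theory.
Local Open Scope ring_scope.
Local Open Scope quotient_scope.

(** * Tensor products *)

Section TensorTheory.
Context {K : fieldType}.
Implicit Types V W Y : lmodType K.

Lemma linear_compose V W Y (f : V -> W) (g : W -> Y) :
  linear f -> linear g -> linear (fun x => g (f x)).
Proof. by move=> fl gl a x y; rewrite fl gl. Qed.

Lemma tensor_sum V W (z : tensor V W) :
  let g : {malg K[(V * W)%type]} := repr z in
  z = \sum_(k <- msupp g) g@_k *: tens k.1 k.2.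
Proof.
move=> g; rewrite -[LHS]quot_piK -/g [X in quot_pi _ X]monalgE linear_sum.
apply: eq_bigr => -[v w] _ /=; rewrite -linearZ; congr (quot_pi _ _).
by apply/malgP => k; rewrite mcoeffZ !mcoeffU mulr_natr.
Qed.

Lemma tensor_ind V W (P : tensor V W -> Prop) :
  (forall v w, P (tens v w)) ->
  (forall a x y, P x -> P y -> P (a *: x + y)) -> forall z, P z.
Proof.
move=> Pt PD z; rewrite (tensor_sum z).
(* Zero is reached as [-1 *: z + z] with [z] a pure tensor. *)
have P0 : P 0 by have := PD (-1) _ _ (Pt 0 0) (Pt 0 0); rewrite scaleN1r addNr.
elim: (X in \sum_(k <- X) _) => [|k s IH]; rewrite ?big_nil // big_cons.
exact: PD.
Qed.

Lemma tensor_lin_eq V W Y (f g : tensor V W -> Y) : linear f -> linear g ->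
  (forall v w, f (tens v w) = g (tens v w)) -> f =1 g.
Proof.
move=> fl gl fg; elim/tensor_ind => // a x y fx fy; by rewrite fl gl fx fy.
Qed.

Lemma linear_lin_tlift V W Y (f : V -> W -> Y) (Z : lmodType K) (z : tensor V W)
    (L : {linear Y -> Z}) :
  L (lin_tlift f z) = lin_tlift (fun v w => L (f v w)) z.
Proof. by rewrite /tlift linear_sum; apply: eq_bigr => k _; rewrite linearZ. Qed.

Lemma eq_lin_tlift V W Y (f g : V -> W -> Y) (z : tensor V W) :
  (forall v w, f v w = g v w) -> lin_tlift f z = lin_tlift g z.
Proof. by move=> fg; rewrite /tlift; apply: eq_bigr => k _; rewrite fg. Qed.

(** [tlift] is a finite sum over a chosen representative, so this is an exchange of two finite sums.
    In Sweedler notation it reorders two independent coproduct sums. *)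
Lemma exchange_lin_tlift V W V' W' Y (f : V -> W -> V' -> W' -> Y)
    (z : tensor V W) (z' : tensor V' W') :
  lin_tlift (fun v w => lin_tlift (f v w) z') z =
  lin_tlift (fun v' w' => lin_tlift (fun v w => f v w v' w') z) z'.
Proof.
rewrite /tlift /=; under eq_bigr do rewrite scaler_sumr.
rewrite exchange_big /=; apply: eq_bigr => k _; rewrite scaler_sumr.
by apply: eq_bigr => k' _; rewrite !scalerA mulrC.
Qed.

Lemma lin_tlift_linear_fun V W Y (Z : lmodType K) (f : Z -> V -> W -> Y)
    (z : tensor V W) :
  (forall v w, linear (fun x => f x v w)) -> linear (fun x => lin_tlift (f x) z).
Proof.
move=> fl a x y; rewrite /tlift scaler_sumr -big_split /=.
by apply: eq_bigr => k _; rewrite fl scalerDr !scalerA mulrC.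
Qed.

Section TensMap.
Context (V W V' W' : lmodType K) (f : {linear V -> V'}) (g : {linear W -> W'}).

Lemma tens_map_linear : linear (tens_map f g).
Proof.
have [bl br] := @tens_bilinear K V' W'.
by apply: lin_tlift_linear; split=> *; rewrite linearP ?bl ?br.
Qed.

HB.instance Definition _ :=
  GRing.isLinear.Build K (tensor V W) (tensor V' W') *:%R (tens_map f g)
    tens_map_linear.
End TensMap.

Lemma tens_map_comp V W V' W' V'' W'' (f : {linear V -> V'})
    (g : {linear W -> W'}) (f' : {linear V' -> V''}) (g' : {linear W' -> W''}) z :
  tens_map f' g' (tens_map f g z) = tens_map (f' \o f) (g' \o g) z.
Proof.
move: z; apply: tensor_lin_eq => [||v w]; last by rewrite !tens_map_tens.
- exact: (linear_compose (@tens_map_linear _ _ _ _ f g)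
                         (@tens_map_linear _ _ _ _ f' g')).
- exact: (@tens_map_linear _ _ _ _ (f' \o f) (g' \o g)).
Qed.

Lemma tens_map_id V W (z : tensor V W) : tens_map idfun idfun z = z.
Proof.
elim/tensor_ind: z => [v w|a x y IHx IHy]; last first.
  by rewrite !tens_map_linear IHx IHy.
by rewrite !tens_map_tens.
Qed.

Lemma tens_assoc_linear V W Y : linear (@tens_assoc K V W Y).
Proof.
have [bl br] := @tens_bilinear K V (tensor W Y).
have [bl' br'] := @tens_bilinear K W Y.
apply: lin_tlift_linear; split=> a.
  move=> x x' y; apply: lin_tlift_linear.
  by split=> *; rewrite ?bl' ?br ?bl.
move=> x; apply: lin_tlift_linear_fun => v w b y y'.
by rewrite br' br.
Qed.

Lemma eq_tens_map V W V' W' (f f' : V -> V') (g g' : W -> W') (z : tensor V W) :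
  f =1 f' -> g =1 g' -> tens_map f g z = tens_map f' g' z.
Proof. by move=> ff gg; apply: eq_lin_tlift => v w; rewrite ff gg. Qed.

Lemma lin_tlift_map V W V' W' Y (f : {linear V -> V'}) (g : {linear W -> W'})
    (h : V' -> W' -> Y) (z : tensor V W) : semibilinear idfun h ->
  lin_tlift h (tens_map f g z) = lin_tlift (fun v w => h (f v) (g w)) z.
Proof.
move=> bh; have [hl hr] := bh.
have bfg : semibilinear idfun (fun v w => h (f v) (g w)).
  by split=> *; rewrite linearP ?hl ?hr.
move: z; apply: tensor_lin_eq => [||v w].
- apply: linear_compose (lin_tlift_linear bh); exact: tens_map_linear.
- exact: lin_tlift_linear.
by rewrite tens_map_tens !lin_tlift_tens.
Qed.

Lemma tens_assoc_map V W Y V' W' Y' (f : {linear V -> V'})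
    (g : {linear W -> W'}) (h : {linear Y -> Y'}) (z : tensor (tensor V W) Y) :
  tens_assoc (tens_map (tens_map f g) h z) =
  tens_map f (tens_map g h) (tens_assoc z).
Proof.
have al (U1 U2 U3 : lmodType K) := @tens_assoc_linear U1 U2 U3.
have [bl _] := @tens_bilinear K (tensor V W) Y.
move: z; apply: tensor_lin_eq => [||x y].
- exact: (linear_compose (@tens_map_linear _ _ _ _ _ _) (al _ _ _)).
- exact: (linear_compose (al _ _ _) (@tens_map_linear _ _ _ _ f (tens_map g h))).
rewrite tens_map_tens; move: x; apply: tensor_lin_eq => [||v w].
- have tl : linear (fun x : tensor V W => tens (tens_map f g x) (h y)).
    have [tl _] := @tens_bilinear K (tensor V' W') Y'.
    by move=> a x x'; rewrite tens_map_linear tl.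
  exact: (linear_compose tl (al _ _ _)).
- apply: (linear_compose (g := fun z => tens_map f (tens_map g h) (tens_assoc z))
      (f := fun x => tens x y)).
    by move=> a x x'; exact: bl.
  exact: (linear_compose (al _ _ _) (@tens_map_linear _ _ _ _ f (tens_map g h))).
rewrite -[X in tens X (h y)]/(tens_map f g (tens v w)) (tens_map_tens f g).
rewrite !tens_assoc_tens (tens_map_tens f (tens_map g h)).
by congr (tens _ _); rewrite -(tens_map_tens g h).
Qed.

End TensorTheory.

(** * Sweedler calculus for coproducts *)

Section Sweedler.
Context {C : numClosedFieldType}.

(** Coassociativity in Sweedler form: a trilinear expression in the three legs does not see which
    leg was split. Both sides are the map [L] induced by [F] on the triple tensor product, evaluated
    at the two sides of [comulA]. *)
Lemma sweedler_coassoc (V Y : lmodType C) (c : coalgebra V)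
    (F : V -> V -> V -> Y) (a : V) :
  (forall y z, linear (fun x => F x y z)) ->
  (forall x z, linear (fun y => F x y z)) ->
  (forall x y, linear (F x y)) ->
  lin_tlift (fun x z => lin_tlift (fun x1 x2 => F x1 x2 z) (comul c x))
    (comul c a) =
  lin_tlift (fun x z => lin_tlift (F x) (comul c z)) (comul c a).
Proof.
move=> F1 F2 F3.
have bF x : semibilinear idfun (F x) by split=> b *; rewrite ?F3 ?F2.
have bG z : semibilinear idfun (fun x1 x2 => F x1 x2 z).
  by split=> b *; rewrite ?F1 ?F2.
pose L (u : tensor V (tensor V V)) := lin_tlift (fun v z => lin_tlift (F v) z) u.
have bL : semibilinear idfun (fun v (z : tensor V V) => lin_tlift (F v) z).
  split=> b; last by move=> x; exact: lin_tlift_linear.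
  by move=> x x' z; apply: lin_tlift_linear_fun => v w.
have Llin : linear L by exact: lin_tlift_linear.
have bl : semibilinear idfun
    (fun x z => lin_tlift (fun x1 x2 => F x1 x2 z) (comul c x)).
  split=> b x x' z; first by rewrite linearP; exact: lin_tlift_linear.
  apply: (@lin_tlift_linear_fun C V V Y V (fun z v w => F v w z)) => v w.
  exact: F3.
have br : semibilinear idfun (fun x z => lin_tlift (F x) (comul c z)).
  split=> b x x' z; last by rewrite linearP; exact: lin_tlift_linear.
  by apply: lin_tlift_linear_fun => v w.
transitivity (L (tens_assoc (tens_map (comul c) idfun (comul c a)))).
  move: (comul c a); apply: tensor_lin_eq => [||x z].
  - exact: lin_tlift_linear.
  - apply: (linear_compose (g := fun u => L (tens_assoc u))).
      exact: tens_map_linear.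
    exact: linear_compose (@tens_assoc_linear _ _ _ _) _.
  rewrite tens_map_tens (lin_tlift_tens _ _ bl).
  move: (comul c x); apply: tensor_lin_eq => [||x1 x2].
  - exact: lin_tlift_linear.
  - apply: (linear_compose (g := fun u => L (tens_assoc u))).
      have [tl _] := @tens_bilinear C (tensor V V) V.
      by move=> b u u'; exact: tl.
    exact: linear_compose (@tens_assoc_linear _ _ _ _) _.
  by rewrite tens_assoc_tens /L !lin_tlift_tens.
rewrite comulA; move: (comul c a); apply: tensor_lin_eq => [||x y].
- apply: linear_compose Llin; exact: tens_map_linear.
- exact: lin_tlift_linear.
by rewrite tens_map_tens /L !lin_tlift_tens.
Qed.

(** Combined with [hcomulM], this turns a sum over the coproduct of a product into a double sum over
    the two coproducts. Both sides are linear in [x] and in [y] and agree on pure tensors. *)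
Lemma sweedler_mul (A : algType C) (Y : lmodType C) (f : A -> A -> Y)
    (x y : tensor A A) : semibilinear idfun f ->
  lin_tlift f (tens_mul x y) =
  lin_tlift (fun a b => lin_tlift (fun c d => f (a * c) (b * d)) y) x.
Proof.
move=> bf; have [fl fr] := bf; have [bl br] := @tens_bilinear C A A.
have bm (Z : lmodType C) (h : A -> A -> Z) : semibilinear idfun h ->
    forall a b, semibilinear idfun (fun c d => h (a * c) (b * d)).
  move=> [hl hr] a b.
  by split=> *; rewrite mulrDr -scalerAr ?hl ?hr.
have bo z (Z : lmodType C) (h : A -> A -> Z) : semibilinear idfun h ->
    semibilinear idfun (fun a b => lin_tlift (fun c d => h (a * c) (b * d)) z).
  move=> [hl hr]; split=> e x1 x2 x3.
    apply: (@lin_tlift_linear_fun C A A Z A (fun a c d => h (a * c) (x3 * d))).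
    by move=> c d e' y1 y2 /=; rewrite mulrDl -scalerAl hl.
  apply: (@lin_tlift_linear_fun C A A Z A (fun b c d => h (x1 * c) (b * d))).
  by move=> c d e' y1 y2 /=; rewrite mulrDl -scalerAl hr.
have lm (z : tensor A A) : linear (fun x : tensor A A => tens_mul x z).
  exact: lin_tlift_linear (bo z _ _ (@tens_bilinear C A A)).
move: x; apply: tensor_lin_eq => [||a b].
- by apply: linear_compose (lm y) _; exact: lin_tlift_linear.
- by apply: lin_tlift_linear; exact: bo.
rewrite lin_tlift_tens; last exact: bo.
have bt : semibilinear idfun (fun c d => tens (a * c) (b * d) : tensor A A).
  exact: (bm _ _ (@tens_bilinear C A A)).
rewrite /tens_mul lin_tlift_tens; last exact: (bo y _ _ (@tens_bilinear C A A)).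
move: y {bo lm}; apply: tensor_lin_eq => [||c d].
- apply: linear_compose; exact: lin_tlift_linear.
- by apply: lin_tlift_linear; exact: bm.
by rewrite !lin_tlift_tens //; exact: bm.
Qed.

End Sweedler.

(** * The antipode is an antihomomorphism *)

Section HopfTau.
Context {C : numClosedFieldType} (A : algType C) (H : hopf_star A).
Local Notation S := (antipode H).
Local Notation D := (comul H).

Lemma antipode1 : S 1 = 1.
Proof.
have := antipodel H 1; rewrite hcomul1 hcounit1 scale1r lin_tlift_tens ?mulr1 //.
by split=> *; rewrite ?linearP ?mulrDl ?mulrDr -?scalerAl -?scalerAr.
Qed.

(* Both sides are convolution inverses of (a, b) |-> a * b on A (x) A. *)
Lemma antipodeM (a b : A) : S (a * b) = S b * S a.
Proof.
have SZ c x : S (c *: x) = c *: S x by rewrite linearZ.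
(* The summand of the triple convolution of S(b)S(a), the product ab, and S(ab). Bracketed to the
   left, the first two factors collapse to counits and leave S(ab); bracketed to the right, the last
   two collapse and leave S(b)S(a). *)
pose T a1 b1 a2 b2 a3 b3 : A := S b1 * S a1 * (a2 * b2) * S (a3 * b3).
transitivity (lin_tlift (fun a' a3 => lin_tlift (fun a1 a2 =>
    lin_tlift (fun b' b3 => lin_tlift (fun b1 b2 => T a1 b1 a2 b2 a3 b3)
      (D b')) (D b)) (D a')) (D a)).
  (* The sum over [a1], [a2] must be contracted first, since S(a1) and a2 stand between S(b1) and
     b2; hence the exchanges of sums. *)
  have E a' a3 : lin_tlift (fun a1 a2 => lin_tlift (fun b' b3 =>
      lin_tlift (fun b1 b2 => T a1 b1 a2 b2 a3 b3) (D b')) (D b)) (D a') =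
      counit H a' *: S (a3 * b).
    rewrite exchange_lin_tlift.
    transitivity (lin_tlift (fun b' b3 =>
        counit H a' *: (counit H b' *: S (a3 * b3))) (D b)).
      apply: eq_lin_tlift => b' b3; rewrite exchange_lin_tlift.
      transitivity (lin_tlift (fun b1 b2 =>
          counit H a' *: (S b1 * b2 * S (a3 * b3))) (D b')).
        apply: eq_lin_tlift => b1 b2.
        transitivity ((S b1 \*o (b2 * S (a3 * b3) \o* idfun))
            (lin_tlift (fun a1 a2 => S a1 * a2) (D a'))).
          by rewrite linear_lin_tlift; apply: eq_lin_tlift => a1 a2; rewrite /T /= !mulrA.
        by rewrite antipodel /= -scalerAl mul1r -scalerAr mulrA.
      transitivity ((counit H a' \*: (S (a3 * b3) \o* idfun))
          (lin_tlift (fun b1 b2 => S b1 * b2) (D b'))).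
        by rewrite linear_lin_tlift.
      by rewrite antipodel /= -scalerAl mul1r.
    rewrite -[in RHS](comul_counitl H b).
    transitivity ((counit H a' \*: (S \o (a3 \*o idfun)))
        (lin_tlift (fun b1 b2 => counit H b1 *: b2) (D b))); last by [].
    rewrite linear_lin_tlift; apply: eq_lin_tlift => b' b3 /=.
    by rewrite -scalerAr SZ.
  transitivity ((S \o (b \o* idfun))
      (lin_tlift (fun a1 a2 => counit H a1 *: a2) (D a))).
    by rewrite comul_counitl.
  rewrite linear_lin_tlift; apply: eq_lin_tlift => a' a3 /=.
  by rewrite E -scalerAl SZ.
(* Rebracketing: coassociativity is applied first to the legs of [a], then to those of [b]. *)
pose G a1 a2 a3 := lin_tlift (fun b' b3 => lin_tlift (fun b1 b2 =>
    T a1 b1 a2 b2 a3 b3) (D b')) (D b).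
rewrite -[LHS]/(lin_tlift (fun a' a3 => lin_tlift (fun a1 a2 => G a1 a2 a3)
    (D a')) (D a)) sweedler_coassoc; last 3 first.
- move=> a2 a3; apply: (@lin_tlift_linear_fun C A A A A
    (fun a1 b' b3 => lin_tlift (fun b1 b2 => T a1 b1 a2 b2 a3 b3) (D b'))).
  move=> b' b3; apply: (@lin_tlift_linear_fun C A A A A
    (fun a1 b1 b2 => T a1 b1 a2 b2 a3 b3)) => b1 b2 c x y.
  by rewrite /T linearP mulrDr !mulrDl -scalerAr -!scalerAl.
- move=> a1 a3; apply: (@lin_tlift_linear_fun C A A A A
    (fun a2 b' b3 => lin_tlift (fun b1 b2 => T a1 b1 a2 b2 a3 b3) (D b'))).
  move=> b' b3; apply: (@lin_tlift_linear_fun C A A A A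
    (fun a2 b1 b2 => T a1 b1 a2 b2 a3 b3)) => b1 b2 c x y.
  by rewrite /T !(mulrDr, mulrDl) -!(scalerAr, scalerAl).
- move=> a1 a2; apply: (@lin_tlift_linear_fun C A A A A
    (fun a3 b' b3 => lin_tlift (fun b1 b2 => T a1 b1 a2 b2 a3 b3) (D b'))).
  move=> b' b3; apply: (@lin_tlift_linear_fun C A A A A
    (fun a3 b1 b2 => T a1 b1 a2 b2 a3 b3)) => b1 b2 c x y.
  by rewrite /T mulrDl -scalerAl linearP mulrDr -scalerAr.
transitivity (lin_tlift (fun a1 a' => lin_tlift (fun a2 a3 =>
    lin_tlift (fun b1 b' => lin_tlift (fun b2 b3 => T a1 b1 a2 b2 a3 b3)
      (D b')) (D b)) (D a')) (D a)).
  apply: eq_lin_tlift => a1 a'; apply: eq_lin_tlift => a2 a3.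
  rewrite /G (@sweedler_coassoc C A A (hcoalg H)
    (fun b1 b2 b3 => T a1 b1 a2 b2 a3 b3)) //.
  - by move=> ? ? c x y; rewrite /T linearP !mulrDl -!scalerAl.
  - by move=> ? ? c x y; rewrite /T !(mulrDr, mulrDl) -!(scalerAr, scalerAl).
  - move=> ? ? c x y.
    by rewrite /T mulrDr -scalerAr linearP mulrDr -scalerAr.
have E a1 a' : lin_tlift (fun a2 a3 => lin_tlift (fun b1 b' =>
    lin_tlift (fun b2 b3 => T a1 b1 a2 b2 a3 b3) (D b')) (D b)) (D a') =
    counit H a' *: (S b * S a1).
  rewrite exchange_lin_tlift.
  transitivity (lin_tlift (fun b1 b' =>
      counit H a' *: (counit H b' *: (S b1 * S a1))) (D b)).
    apply: eq_lin_tlift => b1 b'.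
    (* Since the coproduct is multiplicative, the last two factors form the sum of x S(y) over the
       coproduct of [a' * b'], which the antipode axiom evaluates. *)
    transitivity ((S b1 * S a1 \*o idfun)
        (lin_tlift (fun x y => x * S y) (D (a' * b')))).
      rewrite hcomulM sweedler_mul; last first.
        by split=> c x y z; rewrite ?linearP ?mulrDl ?mulrDr -?scalerAl -?scalerAr.
      rewrite linear_lin_tlift; apply: eq_lin_tlift => a2 a3.
      rewrite linear_lin_tlift; apply: eq_lin_tlift => b2 b3.
      by rewrite /T /= !mulrA.
    by rewrite antipoder /= hcounitM -scalerAr mulr1 scalerA.
  rewrite -[in RHS](comul_counitr H b).
  transitivity ((counit H a' \*: (S a1 \o* S))
      (lin_tlift (fun b1 b2 => counit H b2 *: b1) (D b))); last by [].
  rewrite linear_lin_tlift; apply: eq_lin_tlift => b1 b' /=.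
  by rewrite SZ -scalerAl.
transitivity ((S b \*o S)
    (lin_tlift (fun a1 a2 => counit H a2 *: a1) (D a))); last first.
  by rewrite comul_counitr.
rewrite linear_lin_tlift; apply: eq_lin_tlift => a1 a' /=.
by rewrite E SZ -scalerAr.
Qed.

Lemma star1 : star H 1 = 1.
Proof. by rewrite -[LHS]mulr1 -[X in _ * X](starK H) -starM mulr1 starK. Qed.

Local Notation tauH := (tau (hopf_tau H)).

Lemma tau1 : tauH 1 = 1.
Proof. by rewrite /= antipode1 star1. Qed.

(** The antipode and the involution both reverse products, so their composite preserves the order.
    This allows compatibility with [tau] to be checked on one generator at a time. *)
Lemma tauM a b : tauH (a * b) = tauH a * tauH b.
Proof. by rewrite /= antipodeM starM. Qed.

End HopfTau.

(** * Free algebras and presentations *)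

Section FreeAlgebra.
Context {K : fieldType} {I : choiceType}.
Local Notation free := {malg K[{fmonom I}]}.

Definition malg_ext (M : choiceType) (V : lmodType K) (h : M -> V)
    (p : {malg K[M]}) : V := \sum_(m <- msupp p) p@_m *: h m.

Section MalgExt.
Context (M : choiceType) (V : lmodType K) (h : M -> V).

Lemma malg_extEw (d : {fset M}) (p : {malg K[M]}) : (msupp p `<=` d)%fset ->
  malg_ext h p = \sum_(m <- d) p@_m *: h m.
Proof.
move=> le; rewrite /malg_ext (big_fset_incl _ le) // => k _ /mcoeff_outdom ->.
by rewrite scale0r.
Qed.

Lemma malg_ext_linear : linear (malg_ext h).
Proof.
move=> a p1 p2; pose d := (msupp p1 `|` msupp p2)%fset.
rewrite !(@malg_extEw d) ?fsubsetUl ?fsubsetUr //; last first.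
  rewrite (fsubset_trans (msuppD_le _ _)) // fsetSU //; exact: msuppZ_le.
rewrite scaler_sumr -big_split /=; apply: eq_bigr => k _.
by rewrite mcoeffD mcoeffZ scalerDl scalerA.
Qed.

HB.instance Definition _ :=
  GRing.isLinear.Build K {malg K[M]} V *:%R (malg_ext h) malg_ext_linear.

Lemma malg_extU m : malg_ext h << m >> = h m.
Proof. by rewrite (malg_extEw msuppU_le) big_seq_fset1 mcoeffUU scale1r. Qed.

End MalgExt.

Lemma malg_ind (M : choiceType) (P : {malg K[M]} -> Prop) : P 0 ->
  (forall m, P << m >>) -> (forall a x y, P x -> P y -> P (a *: x + y)) ->
  forall p, P p.
Proof.
move=> P0 PU PD p; rewrite (monalgE p).
elim: (X in \sum_(k <- X) _) => [|m s IH]; rewrite ?big_nil // big_cons.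
suff -> : << p@_m *g m >> = p@_m *: << m >> by exact: PD.
by apply/malgP => k; rewrite mcoeffZ !mcoeffU mulr_natr.
Qed.

Lemma malg_mulZr (M : monomType) a (p q : {malg K[M]}) :
  p * (a *: q) = a *: (p * q).
Proof.
rewrite (malgMEw (d1 := msupp p) (d2 := msupp q) _ (msuppZ_le _ _)) //.
rewrite malgME scaler_sumr; apply: eq_bigr => m _.
rewrite scaler_sumr; apply: eq_bigr => m' _.
apply/malgP => k; by rewrite !mcoeffZ !mcoeffU mulrnAr mulrCA.
Qed.

Lemma free_genM (m : {fmonom I}) i :
  (<< m >> : free) * free_gen i = << mmul m (fmu i) >>.
Proof.
by rewrite /free_gen malgM_def fgmulUU mulr1.
Qed.

(** Words grow by appending letters on the right, the form of induction that suits right modules. *)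
Lemma free_ind (P : free -> Prop) : P 1 ->
  (forall a x y, P x -> P y -> P (a *: x + y)) ->
  (forall x i, P x -> P (x * free_gen i)) -> forall p, P p.
Proof.
move=> P1 PD PM; apply: malg_ind => [|m|//].
  by have := PD (-1) _ _ P1 P1; rewrite scaleN1r addNr.
case: m => m; elim/last_ind: m => [|m i IHm].
  have := P1; rewrite -[1]/(<< mone >>); congr (P << _ >>).
  by apply/val_inj; rewrite /= fm1.
have := PM _ i IHm; rewrite free_genM; congr (P << _ >>); apply/val_inj.
by rewrite /= fmM fmU /= cats1.
Qed.

Section Act.
Context (V : lmodType K) (step : V -> I -> V).
Hypothesis step_linear : forall i, linear (step^~ i).

(** The right action of the free algebra in which each letter [i] acts by [step^~ i], the leftmost
    letter of a word first. *)
Definition act v : free -> V := malg_ext (fun m : {fmonom I} => foldl step v (m : seq I)).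

Lemma act1 v : act v 1 = v.
Proof. by rewrite /act -[1]/(<< mone >>) malg_extU fm1. Qed.

Lemma act_gen v p i : act v (p * free_gen i) = step (act v p) i.
Proof.
rewrite /act; elim/malg_ind: p => [|m|a x y IHx IHy].
- have := step_linear i (-1) 0 0; rewrite scaleN1r addNr scaleN1r addNr.
  by rewrite mul0r linear0.
- by rewrite free_genM !malg_extU fmM fmU cats1 foldl_rcons.
- by rewrite mulrDl -scalerAl !malg_ext_linear IHx IHy step_linear.
Qed.

Lemma act_linear v : linear (act v). Proof. exact: malg_ext_linear. Qed.

Lemma actM v p r : act v (p * r) = act (act v p) r.
Proof.
elim/free_ind: r => [|a x y IHx IHy|x i IH].
- by rewrite mulr1 act1.
- have := act_linear v a (p * x) (p * y); rewrite -malg_mulZr -mulrDr => ->.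
  by have := act_linear (act v p) a x y; rewrite -IHx -IHy => ->.
- by rewrite mulrA !act_gen IH.
Qed.

Lemma act_linearl p : linear (act^~ p).
Proof.
move=> a v w /=; elim/free_ind: p => [|b x y IHx IHy|x i IH].
- by rewrite !act1.
- rewrite !act_linear IHx IHy !scalerDr !scalerA mulrC.
  by rewrite addrACA.
- by rewrite !act_gen IH step_linear.
Qed.

End Act.

Section FreeEval.
Context (A : algType K) (g : I -> A).

Lemma free_eval_linear : linear (free_eval g). Proof. exact: malg_ext_linear. Qed.

HB.instance Definition _ :=
  GRing.isLinear.Build K free A *:%R (free_eval g) free_eval_linear.

(** Evaluation is the orbit map of 1 for right multiplication by the generators, so its
    multiplicativity follows from [actM]. *)
Let free_eval_act p : free_eval g p = act (fun x i => x * g i) 1 p.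
Proof.
rewrite /free_eval /act /malg_ext; apply: eq_bigr => m _; congr (_ *: _).
by elim/last_ind: (m : seq I) => [|s i IH];
  rewrite ?big_nil // -cats1 big_cat big_seq1 foldl_cat /= IH.
Qed.

Let step_linear i : linear (fun x => x * g i).
Proof. by move=> a x y; rewrite mulrDl scalerAl. Qed.

Lemma free_eval1 : free_eval g 1 = 1.
Proof. by rewrite free_eval_act act1. Qed.

Lemma free_eval_mulgen p i : free_eval g (p * free_gen i) = free_eval g p * g i.
Proof. by rewrite !free_eval_act act_gen. Qed.

Lemma free_eval_gen i : free_eval g (free_gen i) = g i.
Proof. by rewrite -[free_gen i]mul1r free_eval_mulgen free_eval1 mul1r. Qed.

Let act_free_eval v p : act (fun x i => x * g i) v p = v * free_eval g p.
Proof.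
elim/free_ind: p => [|a x y IHx IHy|x i IH].
- by rewrite act1 free_eval1 mulr1.
- by rewrite act_linear free_eval_linear IHx IHy mulrDr scalerAr.
- by rewrite act_gen // free_eval_mulgen IH mulrA.
Qed.

Lemma free_evalM p r : free_eval g (p * r) = free_eval g p * free_eval g r.
Proof. by rewrite [LHS]free_eval_act actM // act_free_eval -free_eval_act. Qed.

End FreeEval.

Section Presented.
Context (A : algType K) (g : I -> A) (X : set free).
Hypothesis gX : presented_by g X.

Lemma presented_rel r : X r -> free_eval g r = 0.
Proof.
move=> Xr; apply/gX.2; rewrite /two_sided_ideal; apply: sub_span.
by exists 1, r, 1; rewrite mul1r mulr1.
Qed.

Lemma presented_ind (P : A -> Prop) : P 1 ->
  (forall a x y, P x -> P y -> P (a *: x + y)) ->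
  (forall x i, P x -> P (x * g i)) -> forall x, P x.
Proof.
move=> P1 PD PM x; have [p <-] := gX.1 x.
elim/free_ind: p => [|a y z Py Pz|y i Py].
- by rewrite free_eval1.
- by rewrite free_eval_linear; exact: PD.
- by rewrite free_eval_mulgen; exact: PM.
Qed.

(* A right module over the presented algebra is a family of operators on V, one
   for each generator, satisfying the relations; phi is the orbit map of v0. *)
Lemma presented_module (V : lmodType K) (step : V -> I -> V) (v0 : V) :
  (forall i, linear (step^~ i)) ->
  (forall v r, X r -> act step v r = 0) ->
  exists phi : {linear A -> V},
    phi 1 = v0 /\ forall x i, phi (x * g i) = step (phi x) i.
Proof.
(* [f] acts on [v0] through a chosen preimage of [x] in the free algebra; [fE] shows that the choice
   does not matter. *)
move=> sl sX; pose f x := act step v0 (projT1 (cid (gX.1 x))).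
have act0 v : act step 0 v = 0.
  by have := act_linearl sl v (-1) 0 0; rewrite scaleN1r addNr scaleN1r addNr.
have fE p : f (free_eval g p) = act step v0 p.
  rewrite /f; case: cid => p' /= pp'.
  (* Two preimages differ by a combination of products a r b. Here a sends [v0] to some vector, the
     relation r kills that vector whatever it is, and b keeps 0 at 0. *)
  have /(gX.2 _) [s [sX' e]] : free_eval g (p' - p) = 0.
    by rewrite linearB /= pp' subrr.
  apply/eqP; rewrite -subr_eq0 /act -linearB e linear_sum big_seq big1 // => k ks.
  have [a [r [b [Xr ->]]]] := sX' _ ks.
  by rewrite linearZ /= -/(act _ _ _) !actM // (sX _ _ Xr) act0 scaler0.
have fl : linear f.
  move=> a x y; have [p <-] := gX.1 x; have [p' <-] := gX.1 y.
  by rewrite -linearP !fE act_linear.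
pose F := GRing.isLinear.Build K A V *:%R f fl.
pose phi : {linear A -> V} := HB.pack f F.
exists phi; split; first by rewrite -[RHS](act1 step) -fE free_eval1.
move=> x i; have [p <-] := gX.1 x.
by rewrite /= -free_eval_mulgen !fE act_gen.
Qed.

End Presented.

End FreeAlgebra.

(** * Transport of tau-coalgebra structures *)

Section Transport.
Context {C : numClosedFieldType}.

(** The structure of [W] is pulled back along [f]; since [g] inverts [f], each axiom on [V] becomes
    the same axiom on [W]. *)
Lemma tau_coalgebra_transport (V W : lmodType C) (cW : tau_coalgebra W)
    (f : {linear V -> W}) (g : {linear W -> V}) : cancel f g -> cancel g f ->
  exists cV : tau_coalgebra V, tau_coalg_morphism cV cW f.
Proof.
move=> fK gK.
pose d : {linear V -> tensor V V} := tens_map g g \o (comul cW \o f).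
have dg : d \o g =1 tens_map g g \o comul cW by move=> w; rewrite /d /= gK.
pose e : {scalar V} := counit cW \o f.
have bl : semibilinear idfun (fun a b : V => e a *: b).
  by split=> *; rewrite ?linearP ?scalerDl ?scalerDr !scalerA // mulrC.
have br : semibilinear idfun (fun a b : V => e b *: a).
  by split=> *; rewrite ?linearP ?scalerDl ?scalerDr !scalerA // mulrC.
have dA x : tens_assoc (tens_map d idfun (d x)) = tens_map idfun d (d x).
  (* By [dg], every inner composite of [d] with [g] becomes a coproduct of [W] followed by copies of
     [g]. Pulling these copies outside leaves coassociativity in [W]. *)
  rewrite {2 4}/d /= !tens_map_comp.
  rewrite (eq_tens_map (f' := tens_map g g \o comul cW) (g' := g \o idfun)) //.
  rewrite -(tens_map_comp (comul cW) idfun (tens_map g g) g).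
  rewrite (tens_assoc_map g g g) comulA.
  rewrite (tens_map_comp idfun (comul cW) g (tens_map g g)).
  apply: (@eq_tens_map _ _ _ _ _ (g \o idfun) (idfun \o g)
    (tens_map g g \o comul cW) (d \o g)) => [//|w].
  by rewrite dg.
have dl x : lin_tlift (fun a b => e a *: b) (d x) = x.
  rewrite lin_tlift_map // -[RHS]fK -[f x in RHS](comul_counitl cW).
  by rewrite linear_lin_tlift; apply: eq_lin_tlift => a b; rewrite linearZ /= gK.
have dr x : lin_tlift (fun a b => e b *: a) (d x) = x.
  rewrite lin_tlift_map // -[RHS]fK -[f x in RHS](comul_counitr cW).
  by rewrite linear_lin_tlift; apply: eq_lin_tlift => a b; rewrite linearZ /= gK.
have ta : antilinear (fun x => g (tau cW (f x))).
  by move=> a x y; rewrite !linearP tau_antilinear !linearP.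
exists (TauCoalgebra (Coalgebra dA dl dr) ta); split=> // x /=.
- rewrite tens_map_comp (eq_tens_map (f' := idfun) (g' := idfun)) //.
  by rewrite tens_map_id.
- by rewrite gK.
Qed.

(** First isomorphism theorem. The coideal property is not verified by hand: the structure of [W] is
    transported along the bijection induced by [phi], and [quot_pi] is a morphism because its
    composite with that bijection is [phi]. *)
Lemma tau_coalgebra_quot (V W : lmodType C) (cV : tau_coalgebra V)
    (cW : tau_coalgebra W) (phi : {linear V -> W}) (X : set V) :
  tau_coalg_morphism cV cW phi -> (forall w, exists x, phi x = w) ->
  (forall x, phi x = 0 <-> span X x) ->
  exists cQ : tau_coalgebra (quot X),
    tau_coalg_morphism cV cQ (quot_pi X) /\ tau_coalg_iso cQ cW.
Proof.
move=> [phiD phie phit] phi_surj kerphi.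
pose f (u : quot X) : W := phi (repr u).
have fpi x : f (quot_pi X x) = phi x.
  apply/eqP; rewrite -subr_eq0 -linearB; apply/eqP/kerphi/quot_piP.
  exact: quot_piK.
pose g (w : W) : quot X := quot_pi X (projT1 (cid (phi_surj w))).
have gphi x : g (phi x) = quot_pi X x.
  by rewrite /g; case: cid => y /= e; apply/quot_piP/kerphi; rewrite linearB /= e subrr.
have fl : linear f.
  by move=> a u v; rewrite -[u]quot_piK -[v]quot_piK -linearP !fpi linearP.
have gl : linear g.
  move=> a u v; have [x <-] := phi_surj u; have [y <-] := phi_surj v.
  by rewrite -linearP !gphi linearP.
pose F : {linear quot X -> W} := HB.pack f (GRing.isLinear.Build C _ W *:%R f fl).
pose G : {linear W -> quot X} := HB.pack g (GRing.isLinear.Build C W _ *:%R g gl).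
have FK : cancel F G by move=> u; rewrite -[u]quot_piK /= fpi gphi.
have GK : cancel G F by move=> w; have [x <-] := phi_surj w; rewrite /= gphi fpi.
have [cQ mF] := tau_coalgebra_transport cW FK GK; exists cQ.
have [FD Fe Ft] := mF; split; last by exists F; split=> //; exists G.
split=> x; last 2 first.
- by rewrite -Fe /= fpi.
- by apply: (can_inj FK); rewrite Ft /= !fpi.
(* The tensor square of [F] is injective, so the coproduct identity for [quot_pi] may be checked
   after composing with it, where it becomes that of [phi]. *)
have FFK : cancel (tens_map F F) (tens_map G G).
  move=> z; rewrite (tens_map_comp F F G G) -[RHS]tens_map_id.
  by apply: eq_tens_map => u; exact: FK.
apply: (can_inj FFK); rewrite -FD.
rewrite [F _]fpi phiD (tens_map_comp (quot_pi X) (quot_pi X) F F).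
by apply: eq_tens_map => v; rewrite -fpi.
Qed.

End Transport.

(** * The action of U_q(4) on SU_q(2) *)

Lemma inord_ord2 : (inord 0 = ord0 :> 'I_2) * (inord 1 = ord_max :> 'I_2).
Proof. by split; apply/val_inj; rewrite /= inordK. Qed.

Lemma inord_ord4 :
  ((inord 0 = lshift 2 (ord0 : 'I_2) :> 'I_4) *
   (inord 1 = lshift 2 (ord_max : 'I_2) :> 'I_4)) *
  ((inord 2 = rshift 2 (ord0 : 'I_2) :> 'I_4) *
   (inord 3 = rshift 2 (ord_max : 'I_2) :> 'I_4)).
Proof. by do !split; apply/val_inj; rewrite /= inordK. Qed.

Lemma rev_ord2 :
  (rev_ord ord0 = ord_max :> 'I_2) * (rev_ord ord_max = ord0 :> 'I_2).
Proof. by split; exact: val_inj. Qed.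

Lemma ord2P (a : 'I_2) : a = ord0 \/ a = ord_max.
Proof. by case: a => [[|[|]] h] //; [left|right]; apply/val_inj. Qed.

Section QuantumMatrixAction.
Context {C : numClosedFieldType} (q : C) (A : algType C).
Context (u : 'I_2 -> 'I_2 -> A).

(* In the inr, inr case rev_ord and the sign spell out left multiplication by the
   entries of [[u_22, -u_21], [-u_12, u_11]]. *)
Definition qstep (x : option ('I_4 * 'I_4)) (v : A) : A :=
  if x is Some (i, j) then
    match split (i : 'I_(2 + 2)), split (j : 'I_(2 + 2)) with
    | inl a, inl b => v * u a b
    | inr a, inr b => (-1) ^+ (a + b) *: (u (rev_ord a) (rev_ord b) * v)
    | _, _ => 0
    end
  else v.

Lemma qstep_linear x : linear (qstep x).
Proof.
move=> c v w; case: x => [[i j]|] //=.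
case: (split _) => a; case: (split _) => b; rewrite ?scaler0 ?addr0 //.
  by rewrite mulrDl scalerAl.
by rewrite mulrDr -scalerAr scalerDr !scalerA mulrC.
Qed.

HB.instance Definition _ x :=
  GRing.isLinear.Build C A A *:%R (qstep x) (qstep_linear x).

Lemma qstep_ll (a b : 'I_2) v :
  qstep (Some (lshift 2 a, lshift 2 b)) v = v * u a b.
Proof. by rewrite /qstep (unsplitK (inl a)) (unsplitK (inl b)). Qed.

Lemma qstep_rr (a b : 'I_2) v : qstep (Some (rshift 2 a, rshift 2 b)) v =
  (-1) ^+ (a + b) *: (u (rev_ord a) (rev_ord b) * v).
Proof. by rewrite /qstep (unsplitK (inr a)) (unsplitK (inr b)). Qed.

Lemma qstep_lr (a b : 'I_2) v : qstep (Some (lshift 2 a, rshift 2 b)) v = 0.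
Proof. by rewrite /qstep (unsplitK (inl a)) (unsplitK (inr b)). Qed.

Lemma qstep_rl (a b : 'I_2) v : qstep (Some (rshift 2 a, lshift 2 b)) v = 0.
Proof. by rewrite /qstep (unsplitK (inr a)) (unsplitK (inl b)). Qed.

Local Notation step := (fun v x => qstep x v).
Local Notation free := {malg C[{fmonom option ('I_4 * 'I_4)}]}.
Local Notation gen i j := (free_gen (Some (i, j)) : free).

Lemma act_gen2 v x y :
  act step v (free_gen x * free_gen y) = qstep y (qstep x v).
Proof.
have sl i : linear (step^~ i) by exact: qstep_linear.
by rewrite act_gen // -(mul1r (free_gen x)) act_gen // act1.
Qed.

Lemma actB v (p r : free) c :
  act step v (p - c *: r) = act step v p - c *: act step v r.
Proof. by rewrite /act linearB linearZ.
Qed.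

Lemma act_qstep2 v x y x' y' c :
  act step v (free_gen x * free_gen y - c *: (free_gen x' * free_gen y')) =
  qstep y (qstep x v) - c *: qstep y' (qstep x' v).
Proof.
by apply: etrans (actB _ _ _ _) _; congr (_ - _ *: _); exact: act_gen2.
Qed.

Lemma act_qstep3 v x y x' y' x'' y'' c :
  act step v (free_gen x * free_gen y - free_gen x' * free_gen y'
              - c *: (free_gen x'' * free_gen y'')) =
  qstep y (qstep x v) - qstep y' (qstep x' v) - c *: qstep y'' (qstep x'' v).
Proof.
apply: etrans (actB _ _ _ _) _; congr (_ - _ *: _); last exact: act_gen2.
apply: etrans (linearB _ _ _) _; congr (_ - _); exact: act_gen2.
Qed.

Hypothesis u_rel : forall r, qmatrix_rel q u r -> r = 0.

Let uCol (i j k : 'I_2) : (i < j)%N -> u i k * u j k = q *: (u j k * u i k).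
Proof. by move=> ij; apply/subr0_eq/u_rel/QrelCol. Qed.

Let uRow (i j k : 'I_2) : (i < j)%N -> u k i * u k j = q *: (u k j * u k i).
Proof. by move=> ij; apply/subr0_eq/u_rel/QrelRow. Qed.

Let uComm (i j k l : 'I_2) : (i < j)%N -> (k < l)%N ->
  u i l * u j k = u j k * u i l.
Proof. by move=> ij kl; apply/subr0_eq/u_rel/QrelComm. Qed.

Let uCross (i j k l : 'I_2) : (i < j)%N -> (k < l)%N ->
  u i k * u j l - u j l * u i k = (q - q^-1) *: (u j k * u i l).
Proof. by move=> ij kl; apply/subr0_eq/u_rel/QrelCross. Qed.

Let rev_lt (i j : 'I_2) : (i < j)%N -> (rev_ord j < rev_ord i)%N.
Proof. by case: i j => [[|[|i]] hi] [[|[|j]] hj]. Qed.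

Let blk_lt (a b : 'I_2) : (2 + a < b)%N = false.
Proof. by apply/negbTE; rewrite -leqNgt (leq_trans (ltnW (ltn_ord b))) ?leq_addr. Qed.

(** Within the upper left block these are the relations of [u]. Within the lower right block,
    [rev_ord] reverses the order of indices while left multiplication reverses the order of factors,
    and the two reversals compensate. Generators of different diagonal blocks act on opposite sides
    and commute; all other products act by 0. *)
Lemma act_qmatrix_rel v r : qmatrix_rel q (fun i j => gen i j) r ->
  act step v r = 0.
Proof.
case=> [i j k ij|i j k ij|i j k l ij kl|i j k l ij kl].
- apply: etrans (act_qstep2 _ _ _ _ _ _) _; rewrite /=; move: ij.
  case: splitP => b ->; case: splitP => c _; case: splitP => a ->;
    rewrite ?(mulr0, mul0r, scaler0, subrr) //.
  + by move=> ij; rewrite -!mulrA (uCol _ ij) -scalerAr subrr.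
  + rewrite ltn_add2l => /rev_lt ij; rewrite -!scalerAr !mulrA (uCol _ ij).
    by rewrite !scalerA -scalerAl scalerA mulrC [X in q * X]mulrC mulrA subrr.
- apply: etrans (act_qstep2 _ _ _ _ _ _) _; rewrite /=; move: ij.
  case: splitP => c _; case: splitP => b ->; case: splitP => a ->;
    rewrite ?(mulr0, mul0r, scaler0, subrr) //.
  + by move=> ij; rewrite -!mulrA (uRow _ ij) -scalerAr subrr.
  + rewrite ltn_add2l => /rev_lt ij; rewrite -!scalerAr !mulrA (uRow _ ij).
    by rewrite !scalerA -scalerAl scalerA mulrC [X in q * X]mulrC mulrA subrr.
- rewrite -[gen j k * _]scale1r; apply: etrans (act_qstep2 _ _ _ _ _ _) _.
  rewrite scale1r /=; move: ij kl.
  case: splitP => b ->; case: splitP => c ->; case: splitP => a ->;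
    case: splitP => d ->; rewrite ?(mulr0, mul0r, scaler0, subrr) //;
    rewrite ?ltn_add2l.
  + by move=> ij kl; rewrite -!mulrA (uComm ij kl) subrr.
  + by rewrite -scalerAl mulrA subrr.
  + by rewrite -scalerAl mulrA subrr.
  + move=> /rev_lt ij /rev_lt kl; rewrite -!scalerAr !mulrA !scalerA.
    by rewrite (uComm ij kl) mulrC subrr.
- apply: etrans (act_qstep3 _ _ _ _ _ _ _ _) _; rewrite /=; move: ij kl.
  case: splitP => b ->; case: splitP => d ->; case: splitP => a ->;
    case: splitP => c ->; rewrite ?(mulr0, mul0r, scaler0, subrr, subr0) //;
    (* An index of the second block never precedes one of the first. This excludes the
       configurations in which the cross term pairs the two diagonal blocks and would survive. *)
    rewrite ?ltn_add2l ?blk_lt // => ij kl.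
  + rewrite -!mulrA -mulrBr (uCross ij kl) -scalerAr.
    by rewrite subrr.
  + by rewrite -scalerAl mulrA subrr.
  + have {}ij := rev_lt ij; have {}kl := rev_lt kl.
    rewrite -!scalerAr !scalerA -!mulrA -!exprD.
    (* All three products carry the same total sign exponent a + b + c + d. *)
    rewrite (_ : a + c + (b + d) = b + d + (a + c))%N; last exact: addnC.
    rewrite (_ : a + d + (b + c) = b + d + (a + c))%N; last first.
      by rewrite addnACA [RHS]addnACA [(b + a)%N]addnC.
    rewrite -scalerBr !mulrA -mulrBl (uCross ij kl) -scalerAl scalerA mulrC.
    by rewrite subrr.
Qed.

End QuantumMatrixAction.

Arguments qstep : simpl never.

(** * The quantum determinant acts as the identity *)

Section QuantumDeterminant.
Local Notation o0 := (@Ordinal 4 0 isT).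
Local Notation o1 := (@Ordinal 4 1 isT).
Local Notation o2 := (@Ordinal 4 2 isT).
Local Notation o3 := (@Ordinal 4 3 isT).

Lemma big_ord4 (M : Type) (idx : M) (op : Monoid.law idx) (F : 'I_4 -> M) :
  \big[op/idx]_(i < 4) F i = op (op (op (F o0) (F o1)) (F o2)) (F o3).
Proof.
rewrite !big_ord_recl big_ord0 Monoid.mulm1 !Monoid.mulmA.
by do !congr (op _ _); congr F; apply/val_inj.
Qed.

Let perm_length4 (s : 'S_4) : perm_length s =
  ((s o1 < s o0) + (s o2 < s o0) + (s o3 < s o0) + (s o2 < s o1) +
   (s o3 < s o1) + (s o3 < s o2))%N.
Proof.
rewrite /perm_length -sum1_card big_mkcond /=.
rewrite (eq_bigr (fun p : 'I_4 * 'I_4 =>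
  nat_of_bool ((p.1 < p.2)%N && (s p.2 < s p.1)%N))); last first.
  by move=> p _; rewrite inE; case: (_ && _).
rewrite -(pair_bigA _ (fun i j : 'I_4 => nat_of_bool ((i < j)%N && (s j < s i)%N))) /=.
by rewrite big_ord4 !big_ord4 /= !addn0 !add0n !addnA.
Qed.

Local Notation a01 := (tperm o0 o1).
Local Notation a23 := (tperm o2 o3).

(** Such a permutation preserves both blocks, so it is a product of transpositions inside them. The
    proof enumerates all values and discards the non-injective ones. *)
Let block_perm (s : 'S_4) : (s o0 < 2)%N -> (s o1 < 2)%N ->
  s \in [:: 1%g; a01; a23; (a01 * a23)%g].
Proof.
move=> s0 s1.
have ne i j : i != j -> s i != s j by rewrite (inj_eq (@perm_inj _ s)).
have := ne o0 o1 isT; have := ne o0 o2 isT; have := ne o0 o3 isT.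
have := ne o1 o2 isT; have := ne o1 o3 isT; have := ne o2 o3 isT.
have E (p : 'S_4) : (forall i, i \in [:: o0; o1; o2; o3] -> s i = p i) -> s = p.
  move=> h; apply/permP => i; apply: h.
  by case: i => [[|[|[|[|i]]]] hi] //; rewrite !inE -!val_eqE.
rewrite !inE.
move: s0 s1.
case e0: (s o0) => [[|[|[|[|i0]]]] h0] //; case e1: (s o1) => [[|[|[|[|i1]]]] h1] //;
case e2: (s o2) => [[|[|[|[|i2]]]] h2] //; case e3: (s o3) => [[|[|[|[|i3]]]] h3] //.
all: move=> _ _ _ _ _ _ _ _; apply/or4P.
all: solve [ apply: Or41; apply/eqP/E => i; rewrite !inE => /or4P[]/eqP->;
   rewrite ?e0 ?e1 ?e2 ?e3 ?permM ?permE /=; exact: val_inj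
 | apply: Or42; apply/eqP/E => i; rewrite !inE => /or4P[]/eqP->;
   rewrite ?e0 ?e1 ?e2 ?e3 ?permM ?permE /=; exact: val_inj
 | apply: Or43; apply/eqP/E => i; rewrite !inE => /or4P[]/eqP->;
   rewrite ?e0 ?e1 ?e2 ?e3 ?permM ?permE /=; exact: val_inj
 | apply: Or44; apply/eqP/E => i; rewrite !inE => /or4P[]/eqP->;
   rewrite ?e0 ?e1 ?e2 ?e3 ?permM ?permE /=; exact: val_inj].
Qed.

Context {C : numClosedFieldType} (q : C) (A : algType C).
Context (u : 'I_2 -> 'I_2 -> A).
Hypothesis uComm : u ord0 ord_max * u ord_max ord0 = u ord_max ord0 * u ord0 ord_max.
Hypothesis uDet : u ord0 ord0 * u ord_max ord_max
  - q *: (u ord0 ord_max * u ord_max ord0) = 1.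

Local Notation step := (fun v x => qstep u x v).
Local Notation free := {malg C[{fmonom option ('I_4 * 'I_4)}]}.
Local Notation gen i j := (free_gen (Some (i, j)) : free).

(** A permutation that moves one of the first two indices out of its block contributes an off-block
    factor, which acts by 0. The four remaining terms factor as left multiplication by the
    determinant of [u] and right multiplication by the same determinant, which is 1. *)
Lemma act_qdet v : act step v (qdet q (fun i j => gen i j)) = v.
Proof.
pose G (s : 'S_4) v := qstep u (Some (s o3, o3)) (qstep u (Some (s o2, o2))
  (qstep u (Some (s o1, o1)) (qstep u (Some (s o0, o0)) v))).
have sl i : linear (step^~ i) by exact: qstep_linear.
have actG (s : 'S_4) : act step v (\prod_(i < 4) gen (s i) i) = G s v.
  by rewrite big_ord4 act_gen // act_gen // act_gen2.
have -> : act step v (qdet q (fun i j => gen i j)) =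
    \sum_s (- q) ^+ perm_length s *: G s v.
  rewrite /qdet /act linear_sum; apply: eq_bigr => s _.
  by rewrite linearZ; congr (_ *: _); exact: actG.
have split01 (i : 'I_4) : (i < 2)%N = false ->
    forall (j : 'I_4), (j < 2)%N -> forall w, qstep u (Some (i, j)) w = 0.
  move=> i2 j j2 w; rewrite /qstep; move: i2 j2.
  case: splitP => a ->; case: splitP => b -> //; by rewrite ltn_ord.
pose r := [:: 1%g; a01; a23; (a01 * a23)%g].
transitivity (\sum_(s in r) (- q) ^+ perm_length s *: G s v).
  apply/esym/big_rmcond => s sr; rewrite /G.
  have [s0|s0] := boolP (s o0 < 2)%N; last first.
    by rewrite (split01 (s o0)) ?linear0 ?scaler0 //; exact/negbTE.
  have [s1|s1] := boolP (s o1 < 2)%N; last first.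
    by rewrite (split01 (s o1)) ?linear0 ?scaler0 //; exact/negbTE.
  by rewrite block_perm in sr.
rewrite -big_uniq; last first.
  (* The values at [o0] and [o2] tell the four permutations apart. *)
  apply: (@map_uniq _ _ (fun s : 'S_4 => (s o0, s o2))).
  by rewrite /= !permM !permE.
have E0 : o0 = lshift 2 (ord0 : 'I_2) by exact: val_inj.
have E1 : o1 = lshift 2 (ord_max : 'I_2) by exact: val_inj.
have E2 : o2 = rshift 2 (ord0 : 'I_2) by exact: val_inj.
have E3 : o3 = rshift 2 (ord_max : 'I_2) by exact: val_inj.
rewrite !big_cons big_nil !perm_length4 /G !permM !permE /=.
rewrite E0 E1 E2 E3 !(qstep_ll, qstep_rr) !rev_ord2 /= addr0.
(* In both factors the off-diagonal product comes out as u_21 u_12, so the determinant relation is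
   first brought to that form. *)
have uDet' := uDet; rewrite uComm in uDet'.
rewrite -[RHS]mul1r -[RHS]mulr1 -{1}uDet' -{1}uDet' !addn0 expr0 expr1.
rewrite !mulrBl !mulrBr -!scalerAl -!scalerAr !scalerA !mulrA.
rewrite !expr0 !expr1 !expr2 !(mulr1, mul1r, mulrN1, mulN1r, mulrNN, mulNr, opprK, mulrN).
rewrite scale1r !scaleNr !opprB -!addrA; congr (_ + _).
by congr (_ + _); exact: addrC.
Qed.

Hypothesis u_rel : forall r, qmatrix_rel q u r -> r = 0.

(** Since D_q acts as the identity, letting D_q^-1 act as the identity respects both invertibility
    relations. *)
Lemma act_Uq_rel v r :
  Uq_rel q (fun i j => gen i j) (free_gen None) r -> act step v r = 0.
Proof.
have sl i : linear (step^~ i) by exact: qstep_linear.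
have act1B p : act step v (p - 1) = act step v p - v.
  by apply: etrans (linearB _ _ _) _; congr (_ - _); exact: act1.
case=> [{}r rr||]; first exact: act_qmatrix_rel rr.
- apply: etrans (act1B _) _; apply/eqP; rewrite subr_eq0; apply/eqP.
  by apply: etrans (act_gen sl _ _ _) _; exact: act_qdet.
- apply: etrans (act1B _) _; apply/eqP; rewrite subr_eq0; apply/eqP.
  apply: etrans (actM sl _ _ _) _; apply: etrans (act_qdet _) _.
  by rewrite -(mul1r (free_gen None)) (act_gen sl) act1.
Qed.

End QuantumDeterminant.

(** * Quadratic relations in a presented algebra *)

Section PresentedRelations.
Context {C : numClosedFieldType} (q : C) (I : choiceType) (A : algType C).
Context (g : I -> A) (X : set {malg C[{fmonom I}]}).
Hypothesis gX : presented_by g X.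

Lemma free_eval_gen2 x y :
  free_eval g (free_gen x * free_gen y) = g x * g y.
Proof. by rewrite free_eval_mulgen free_eval_gen. Qed.

Lemma free_eval_quad2 x y x' y' c :
  free_eval g (free_gen x * free_gen y - c *: (free_gen x' * free_gen y')) =
  g x * g y - c *: (g x' * g y').
Proof.
apply: etrans (linearB _ _ _) _; congr (_ - _); first exact: free_eval_gen2.
by apply: etrans (linearZ_LR _ _ _) _; congr (_ *: _); exact: free_eval_gen2.
Qed.

Lemma free_eval_quad3 x y x' y' x'' y'' c :
  free_eval g (free_gen x * free_gen y - free_gen x' * free_gen y'
               - c *: (free_gen x'' * free_gen y'')) =
  g x * g y - g x' * g y' - c *: (g x'' * g y'').
Proof.
apply: etrans (linearB _ _ _) _; congr (_ - _).
  apply: etrans (linearB _ _ _) _; congr (_ - _); exact: free_eval_gen2.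
by apply: etrans (linearZ_LR _ _ _) _; congr (_ *: _); exact: free_eval_gen2.
Qed.

Lemma presented_qmatrix_rel n (f : 'I_n -> 'I_n -> I) :
  (forall r, qmatrix_rel q (fun i j => free_gen (f i j)) r -> X r) ->
  forall r, qmatrix_rel q (fun i j => g (f i j)) r -> r = 0.
Proof.
move=> fX r; case=> [i j k ij|i j k ij|i j k l ij kl|i j k l ij kl].
- rewrite -free_eval_quad2; apply: (presented_rel gX); apply: fX.
  exact: (QrelCol q (fun i j => free_gen (f i j))).
- rewrite -free_eval_quad2; apply: (presented_rel gX); apply: fX.
  exact: (QrelRow q (fun i j => free_gen (f i j))).
- rewrite -!free_eval_gen2 -linearB; apply: (presented_rel gX); apply: fX.
  exact: (QrelComm q (fun i j => free_gen (f i j))).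
- rewrite -free_eval_quad3; apply: (presented_rel gX); apply: fX.
  exact: (QrelCross q (fun i j => free_gen (f i j))).
Qed.

End PresentedRelations.

(** * The orbit map from U_q(4) to SU_q(2) *)

Section Comparison.
Context {C : numClosedFieldType} (q : C).
Context (U : algType C) (HU : hopf_star U).
Context (t : 'I_4 -> 'I_4 -> U) (Dinv : U) (hU : is_Uq q HU t Dinv).
Context (SU : algType C) (HSU : hopf_star SU).
Context (u : 'I_2 -> 'I_2 -> SU) (hSU : is_SUq2 q HSU u).

Local Notation gU := (Uq_gen t Dinv).

Lemma SUq2_qmatrix0 r : qmatrix_rel q u r -> r = 0.
Proof.
apply: (presented_qmatrix_rel (SUq2_presented hSU) (f := pair)) => p.
exact: SUq2Quad.
Qed.

Lemma Uq_qmatrix0 r : qmatrix_rel q t r -> r = 0.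
Proof.
apply: (presented_qmatrix_rel (Uq_presented hU) (f := fun i j => Some (i, j))) => p.
exact: UqQuad.
Qed.

Lemma SUq2_qdet1 : u ord0 ord0 * u ord_max ord_max
  - q *: (u ord0 ord_max * u ord_max ord0) = 1.
Proof.
apply/eqP; rewrite -subr_eq0; apply/eqP.
have := presented_rel (SUq2_presented hSU) (SUq2Det q (fun i j => free_gen (i, j))).
rewrite /ent /= !inord_ord2 => <-.
apply/esym; apply: etrans (linearB _ _ _) _; congr (_ - _).
  exact: free_eval_quad2.
exact: free_eval1.
Qed.

Lemma SUq2_antidiag_comm :
  u ord0 ord_max * u ord_max ord0 = u ord_max ord0 * u ord0 ord_max.
Proof. by apply/subr0_eq/SUq2_qmatrix0/QrelComm. Qed.

Lemma comparison_map : exists phi : {linear U -> SU},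
  phi 1 = 1 /\ forall x i, phi (x * gU i) = qstep u i (phi x).
Proof.
apply: (presented_module (Uq_presented hU) (step := fun v x => qstep u x v)).
  by move=> x; exact: qstep_linear.
move=> v r; apply: act_Uq_rel.
- exact: SUq2_antidiag_comm.
- exact: SUq2_qdet1.
- exact: SUq2_qmatrix0.
Qed.

End Comparison.

(** * Products in the tensor square *)

Section TensorAlgebra.
Context {K : fieldType} (A : algType K).

Lemma tens_mul_linearr (x : tensor A A) : linear (tens_mul x).
Proof.
have [bl br] := @tens_bilinear K A A.
apply: lin_tlift_linear_fun => a b; apply: lin_tlift_linear.
by split=> *; rewrite mulrDr -scalerAr ?bl ?br.
Qed.

Lemma tens_mul_tensl (a b : A) (z : tensor A A) :
  tens_mul (tens a b) z = tens_map (a \*o idfun) (b \*o idfun) z.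
Proof.
move: z; apply: tensor_lin_eq => [||c d].
- exact: tens_mul_linearr.
- exact: tens_map_linear.
by rewrite tens_mul_tens tens_map_tens.
Qed.

Lemma tens_mul_tensr (a b : A) (z : tensor A A) :
  tens_mul z (tens a b) = tens_map (a \o* idfun) (b \o* idfun) z.
Proof.
have [bl br] := @tens_bilinear K A A.
rewrite /tens_mul /tens_map; apply: eq_lin_tlift => c d.
have b2 : semibilinear idfun (fun a b => tens (c * a) (d * b) : tensor A A).
  by split=> *; rewrite mulrDr -scalerAr ?bl ?br.
exact: (lin_tlift_tens a b b2).
Qed.

Lemma tens_mul_linearl (z : tensor A A) : linear (fun x : tensor A A => tens_mul x z).
Proof.
have [bl br] := @tens_bilinear K A A.
apply: lin_tlift_linear; split=> c x y w.
  apply: (@lin_tlift_linear_fun K A A (tensor A A) A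
    (fun a b d => tens (a * b) (w * d))).
  by move=> b d e ? ? /=; rewrite mulrDl -scalerAl bl.
apply: (@lin_tlift_linear_fun K A A (tensor A A) A
  (fun a b d => tens (x * b) (a * d))).
by move=> b d e ? ? /=; rewrite mulrDl -scalerAl br.
Qed.

Lemma linear_fun_sum (V W : lmodType K) (f : V -> W) (I : Type) (r : seq I)
    (F : I -> V) : linear f -> f (\sum_(i <- r) F i) = \sum_(i <- r) f (F i).
Proof.
move=> fl; pose h : {linear V -> W} := HB.pack f (GRing.isLinear.Build K V W *:%R f fl).
exact: (linear_sum h).
Qed.

Lemma tens_mul_sumr (x : tensor A A) (I : Type) (r : seq I) (F : I -> tensor A A) :
  tens_mul x (\sum_(i <- r) F i) = \sum_(i <- r) tens_mul x (F i).
Proof. exact: linear_fun_sum (tens_mul_linearr x). Qed.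

Lemma tens_mul_suml (x : tensor A A) (I : Type) (r : seq I) (F : I -> tensor A A) :
  tens_mul (\sum_(i <- r) F i) x = \sum_(i <- r) tens_mul (F i) x.
Proof. exact: (linear_fun_sum _ _ (tens_mul_linearl x)). Qed.

Lemma tens_mapZ (V W V' W' : lmodType K) (f : V -> V') (g : W -> W') c d
    (z : tensor V W) :
  tens_map (fun v => c *: f v) (fun w => d *: g w) z = (c * d) *: tens_map f g z.
Proof.
have [bl br] := @tens_bilinear K V' W'.
have Zl a v w : tens (a *: v) w = a *: tens v w :> tensor V' W'.
  have := bl a v (0 *: v) w; rewrite scale0r addr0 => ->.
  by have := bl (-1) 0 0 w; rewrite scaler0 addr0 scaleN1r addNr => ->; rewrite addr0.
have Zr a v w : tens v (a *: w) = a *: tens v w :> tensor V' W'.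
  have := br a v w (0 *: w); rewrite scale0r addr0 => ->.
  by have := br (-1) v 0 0; rewrite scaler0 addr0 scaleN1r addNr => ->; rewrite addr0.
rewrite /tens_map /tlift scaler_sumr; apply: eq_bigr => k _.
by rewrite Zl Zr !scalerA; congr (_ *: _); exact: mulrC.
Qed.

Lemma tens_map0 (V W V' W' : lmodType K) (f : V -> V') (g : W -> W')
    (z : tensor V W) : (forall v, f v = 0) \/ (forall w, g w = 0) ->
  tens_map f g z = 0.
Proof.
case=> h.
  (* A function that vanishes everywhere equals its own multiple by 0, and [tens_mapZ] pulls that 0
     out. *)
  rewrite (@eq_tens_map _ _ _ _ _ f (fun v => (0 : K) *: f v) g
    (fun w => (1 : K) *: g w)) => [|v|v].
  - by rewrite tens_mapZ mul0r scale0r.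
  - by rewrite scale0r h.
  - by rewrite scale1r.
rewrite (@eq_tens_map _ _ _ _ _ f (fun v => (1 : K) *: f v) g
  (fun w => (0 : K) *: g w)) => [|v|v].
- by rewrite tens_mapZ mulr0 scale0r.
- by rewrite scale1r.
- by rewrite scale0r h.
Qed.

End TensorAlgebra.

(** * The comparison map is a tau-coalgebra morphism *)

Section ComparisonCoalgebra.
Context {C : numClosedFieldType} (q : C).
Context (U : algType C) (HU : hopf_star U).
Context (t : 'I_4 -> 'I_4 -> U) (Dinv : U) (hU : is_Uq q HU t Dinv).
Context (SU : algType C) (HSU : hopf_star SU).
Context (u : 'I_2 -> 'I_2 -> SU) (hSU : is_SUq2 q HSU u).

Local Notation gU := (Uq_gen t Dinv).
Local Notation D := (qdet q t).

Lemma free_eval_qdet :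
  free_eval gU (qdet q (fun i j => free_gen (Some (i, j)))) = D.
Proof.
have E (s : 'S_4) : free_eval gU
    (\prod_(i < 4) free_gen (Some (s i, i))) = \prod_(i < 4) t (s i) i.
  by rewrite !big_ord4 !free_eval_mulgen free_eval_gen.
rewrite /qdet linear_sum; apply: eq_bigr => s _.
by apply: etrans (linearZ_LR _ _ _) _; congr (_ *: _); exact: E.
Qed.

Lemma qdet_mulV : D * Dinv = 1.
Proof.
apply/eqP; rewrite -subr_eq0; apply/eqP.
have <- := presented_rel (Uq_presented hU) (UqDetr q _ _).
apply/esym; apply: etrans (linearB _ _ _) _; congr (_ - _).
  by apply: etrans (free_eval_mulgen _ _ _) _; rewrite free_eval_qdet.
exact: free_eval1.
Qed.

Lemma qdet_Vmul : Dinv * D = 1.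
Proof.
apply/eqP; rewrite -subr_eq0; apply/eqP.
have <- := presented_rel (Uq_presented hU) (UqDetl q _ _).
apply/esym; apply: etrans (linearB _ _ _) _; congr (_ - _).
  apply: etrans (free_evalM _ _ _) _.
  by rewrite free_eval_qdet free_eval_gen.
exact: free_eval1.
Qed.

(** The coproduct of SU_q(2) is compatible with the module structure. If [i] and [j] lie in
    different blocks, each summand contains an off-block factor; if they lie in the same block, only
    the [k] of that block survive. *)
Lemma comul_qstep i j y : comul HSU (qstep u (Some (i, j)) y) =
  \sum_(k < 4) tens_map (qstep u (Some (i, k))) (qstep u (Some (k, j)))
    (comul HSU y).
Proof.
rewrite (@big_split_ord _ _ _ 2 2) /=.
case: (@split_ordP 2 2 i) => a ->; case: (@split_ordP 2 2 j) => b ->.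
- rewrite [X in _ + X]big1 ?addr0 => [|k _]; last first.
    by apply: tens_map0; left=> v; exact: qstep_lr.
  rewrite qstep_ll hcomulM (SUq2_comul hSU) tens_mul_sumr.
  apply: eq_bigr => k _; rewrite tens_mul_tensr.
  by apply: eq_tens_map => v; rewrite qstep_ll.
- rewrite qstep_lr linear0 [X in _ + X]big1 ?addr0 => [|k _]; last first.
    by apply: tens_map0; left=> v; exact: qstep_lr.
  rewrite big1 => [|k _]; first by [].
  by apply: tens_map0; right=> v; exact: qstep_lr.
- rewrite qstep_rl linear0 [X in _ + X]big1 ?addr0 => [|k _]; last first.
    by apply: tens_map0; right=> v; exact: qstep_rl.
  rewrite big1 => [|k _]; first by [].
  by apply: tens_map0; left=> v; exact: qstep_rl.
rewrite [X in X + _]big1 ?add0r => [|k _]; last first.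
  by apply: tens_map0; left=> v; exact: qstep_rl.
rewrite qstep_rr linearZ /= hcomulM (SUq2_comul hSU) tens_mul_suml scaler_sumr.
(* [qstep] also reverses the middle index [k], so the sum from the coproduct of [u] is reversed to
   match; the two signs in [k] then cancel. *)
rewrite (reindex_inj rev_ord_inj) /=; apply: eq_bigr => k _.
rewrite tens_mul_tensl.
rewrite [RHS](@eq_tens_map _ _ _ _ _ _
   (fun v => (-1) ^+ (a + k) *: (u (rev_ord a) (rev_ord k) * v)) _
   (fun v => (-1) ^+ (k + b) *: (u (rev_ord k) (rev_ord b) * v))) => [|v|v];
  try exact: qstep_rr.
rewrite [RHS]tens_mapZ.
have -> : (-1) ^+ (a + k) * (-1) ^+ (k + b) = (-1) ^+ (a + b) :> C.
  by rewrite !exprD mulrA -(mulrA ((-1) ^+ a)) -expr2 sqrr_sign mulr1.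
reflexivity.
Qed.

Lemma counit_qstep i j y :
  counit HSU (qstep u (Some (i, j)) y) = (i == j)%:R * counit HSU y.
Proof.
have E (i' j' : 'I_4) : (i' == j') = (i' == j' :> nat) by [].
case: (@split_ordP 2 2 i) => a ->; case: (@split_ordP 2 2 j) => b ->;
  rewrite E /=.
- by rewrite qstep_ll hcounitM (SUq2_counit hSU) mulrC.
- by rewrite qstep_lr ltn_eqF ?mul0r ?linear0 // (leq_trans (ltn_ord a)) ?leq_addr.
- by rewrite qstep_rl gtn_eqF ?mul0r ?linear0 // (leq_trans (ltn_ord b)) ?leq_addr.
rewrite qstep_rr linearZ /= hcounitM (SUq2_counit hSU) (inj_eq rev_ord_inj).
rewrite eqn_add2l val_eqE.
case: eqP => [->|_]; last by rewrite mul0r mulr0.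
by rewrite exprD -expr2 sqrr_sign mul1r.
Qed.

(** From u_ij^* = S(u_ji), [tau] transposes the entries of [u]. Being multiplicative, it keeps left
    multiplications left and right ones right, and the sign is symmetric in the two indices. *)
Lemma tau_qstep i j y : tau (hopf_tau HSU) (qstep u (Some (i, j)) y) =
  qstep u (Some (j, i)) (tau (hopf_tau HSU) y).
Proof.
have tau_u a b : tau (hopf_tau HSU) (u a b) = u b a.
  by rewrite /= -(SUq2_star hSU) starK.
have tau0 : tau (hopf_tau HSU) 0 = 0.
  have := tau_antilinear (hopf_tau HSU) (-1) 0 0.
  by rewrite scaler0 addr0 rmorphN1 scaleN1r addNr.
case: (@split_ordP 2 2 i) => a ->; case: (@split_ordP 2 2 j) => b ->.
- by rewrite !qstep_ll tauM tau_u.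
- by rewrite qstep_lr qstep_rl tau0.
- by rewrite qstep_lr qstep_rl tau0.
rewrite !qstep_rr; have := tau_antilinear (hopf_tau HSU).
move=> /(_ ((-1) ^+ (a + b)) (u (rev_ord a) (rev_ord b) * y) 0).
by rewrite !addr0 tau0 addr0 tauM tau_u rmorph_sign addnC => ->.
Qed.

Context (phi : {linear U -> SU}) (phi1 : phi 1 = 1).
Hypothesis phiM : forall x i, phi (x * gU i) = qstep u i (phi x).

Lemma comparison_mul_t x i j : phi (x * t i j) = qstep u (Some (i, j)) (phi x).
Proof. exact: (phiM x (Some (i, j))). Qed.

Lemma comparison_mul_Dinv x : phi (x * Dinv) = phi x.
Proof. exact: (phiM x None). Qed.

(** As D_q^-1 acts trivially, x D_q has the same image as x D_q D_q^-1 = x. *)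
Lemma comparison_mul_qdet x : phi (x * D) = phi x.
Proof. by rewrite -comparison_mul_Dinv -mulrA qdet_mulV mulr1. Qed.

Lemma comparison_comul x : comul HSU (phi x) = tens_map phi phi (comul HU x).
Proof.
elim/(presented_ind (Uq_presented hU)): x => [|a x y IHx IHy|x [[i j]|] IH].
- by rewrite phi1 !hcomul1 tens_map_tens phi1.
- by rewrite !linearP IHx IHy.
- rewrite phiM comul_qstep hcomulM (Uq_comul hU) tens_mul_sumr.
  rewrite (linear_fun_sum _ _ (tens_map_linear phi phi)).
  apply: eq_bigr => k _; rewrite IH tens_mul_tensr !(tens_map_comp phi phi).
  rewrite tens_map_comp; apply: eq_tens_map => v /=; exact/esym/comparison_mul_t.
(* Multiplying by the grouplike D inside (phi (x) phi) changes nothing, so D can be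
   used to cancel the coproduct of its inverse. *)
- have phiDD z : tens_map phi phi (tens_mul z (tens D D)) = tens_map phi phi z.
    rewrite tens_mul_tensr (tens_map_comp (D \o* idfun) (D \o* idfun) phi phi).
    by apply: eq_tens_map => v /=; exact: comparison_mul_qdet.
  rewrite -[RHS]phiDD -(Uq_comulD hU) -hcomulM /= -mulrA qdet_Vmul mulr1.
  by rewrite comparison_mul_Dinv.
Qed.

Lemma comparison_counit x : counit HSU (phi x) = counit HU x.
Proof.
elim/(presented_ind (Uq_presented hU)): x => [|a x y IHx IHy|x [[i j]|] IH].
- by rewrite phi1 !hcounit1.
- by rewrite !linearP IHx IHy.
- by rewrite phiM counit_qstep IH hcounitM (Uq_counit hU) mulrC.
have eV : counit HU Dinv = 1.
  by have := hcounitM HU D Dinv; rewrite qdet_mulV hcounit1 (Uq_counitD hU) mul1r.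
by rewrite /= comparison_mul_Dinv IH hcounitM eV mulr1.
Qed.

Lemma tau_Uq_gen i j : tau (hopf_tau HU) (t i j) = t j i.
Proof. by rewrite /= -(Uq_star hU) starK. Qed.

(** D_q is grouplike, so the antipode exchanges D_q and D_q^-1; the involution sends D_q back to
    D_q^-1. *)
Lemma tau_qdetV : tau (hopf_tau HU) Dinv = Dinv.
Proof.
have SD : antipode HU D = Dinv.
  have : antipode HU D * D = 1.
    have := antipodel HU D; rewrite (Uq_comulD hU) (Uq_counitD hU) scale1r.
    rewrite lin_tlift_tens //.
    by split=> *; rewrite ?linearP ?mulrDl ?mulrDr -?scalerAl -?scalerAr.
  move=> e; by rewrite -[LHS]mulr1 -qdet_mulV mulrA e mul1r.
have SV : antipode HU Dinv = D.
  have e : antipode HU Dinv * Dinv = 1.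
    by rewrite -{2}SD -antipodeM qdet_mulV antipode1.
  by rewrite -[LHS]mulr1 -qdet_Vmul mulrA e mul1r.
by rewrite /= SV (Uq_starD hU).
Qed.

Lemma comparison_tau x : phi (tau (hopf_tau HU) x) = tau (hopf_tau HSU) (phi x).
Proof.
elim/(presented_ind (Uq_presented hU)): x => [|a x y IHx IHy|x [[i j]|] IH].
- by rewrite tau1 phi1 tau1.
- rewrite (tau_antilinear (hopf_tau HU)) !linearP IHx IHy.
  by rewrite (tau_antilinear (hopf_tau HSU)).
- rewrite tauM [Uq_gen _ _ _]/= tau_Uq_gen comparison_mul_t IH -tau_qstep.
  by rewrite -comparison_mul_t.
- by rewrite tauM [Uq_gen _ _ _]/= tau_qdetV !comparison_mul_Dinv.
Qed.

End ComparisonCoalgebra.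

(** * Reduction to the upper left block *)

Lemma span_ind (K : fieldType) (V : lmodType K) (X : set V) (P : V -> Prop) :
  P 0 -> (forall a x y, X x -> P y -> P (a *: x + y)) ->
  forall x, span X x -> P x.
Proof.
move=> P0 PD x [s [sX ->]]; elim: s sX => [|p s IH] sX; rewrite ?big_nil //.
rewrite big_cons; apply: PD; first by apply: sX; exact: mem_head.
by apply: IH => r rs; apply: sX; rewrite inE rs orbT.
Qed.

Section BlockReduction.
Context {C : numClosedFieldType} (q : C) (U : algType C) (t : 'I_4 -> 'I_4 -> U).
Hypothesis t_rel : forall r, qmatrix_rel q t r -> r = 0.

Local Notation RI := (right_ideal (Rspan q t)).
Local Notation N := (quot_pi RI).
Local Notation block := (fun i j : 'I_2 => t (lshift 2 i) (lshift 2 j)).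

Lemma quot_pi0P x : N x = 0 <-> span RI x.
Proof. by rewrite -(linear0 N) quot_piP subr0. Qed.

(* RI is only a right ideal, so congruences can be multiplied on the right only. *)
Lemma quot_pi_mulr x a : N x = 0 -> N (x * a) = 0.
Proof.
move=> /quot_pi0P; elim/span_ind => [|c {}x y xR IH]; first by rewrite mul0r linear0.
rewrite mulrDl -scalerAl linearP /= IH addr0.
suff -> : N (x * a) = 0 by rewrite scaler0.
elim/span_ind: xR => [|d r z [r' [e [Rr' ->]]] IHz]; first by rewrite mul0r linear0.
rewrite mulrDl -scalerAl linearP /= IHz addr0 -mulrA.
suff -> : N (r' * (e * a)) = 0 by rewrite scaler0.
by apply/quot_pi0P; do 2!apply: sub_span; exists r', (e * a).
Qed.

Lemma quot_pi_mulr_eq x y a : N x = N y -> N (x * a) = N (y * a).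
Proof.
move=> e; apply/eqP; rewrite -subr_eq0 -linearB -mulrBl; apply/eqP/quot_pi_mulr.
by rewrite linearB /= e subrr.
Qed.

Lemma quot_pi_Rspan r a : r \in
  [:: ent t 1 3; ent t 3 1; ent t 1 4; ent t 4 1; ent t 2 4; ent t 4 2;
      ent t 2 3; ent t 3 2; ent t 1 1 - ent t 4 4; ent t 1 2 + ent t 4 3;
      ent t 2 1 + ent t 3 4; ent t 2 2 - ent t 3 3;
      ent t 1 1 * ent t 2 2 - q *: (ent t 1 2 * ent t 2 1) - 1 ] ->
  N (r * a) = 0.
Proof.
move=> rR; apply: quot_pi_mulr; apply/quot_pi0P.
apply: sub_span; apply: sub_span; exists r, 1; rewrite mulr1.
by split=> //; exact: sub_span.
Qed.

Definition off_block (i j : 'I_4) := (i < 2)%N != (j < 2)%N.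

Lemma quot_pi_off i j a : off_block i j -> N (t i j * a) = 0.
Proof.
move=> ij; apply: quot_pi_Rspan; move: ij.
rewrite /off_block /ent /= !inord_ord4.
case: (@split_ordP 2 2 i) => c ->; case: (@split_ordP 2 2 j) => d -> //=;
  rewrite ?ltn_ord //= => _; case: (ord2P c) => ->; case: (ord2P d) => ->;
  by rewrite !inE eqxx ?orbT.
Qed.

(** The linear generators of R replace a leading t_33, t_34, t_43, t_44 by t_22, -t_21, -t_12, t_11,
    the pattern encoded in [qstep]. *)
Lemma quot_pi_rr (c d : 'I_2) a : N (t (rshift 2 c) (rshift 2 d) * a) =
  (-1) ^+ (c + d) *: N (block (rev_ord c) (rev_ord d) * a).
Proof.
have E x y : N ((x - y) * a) = 0 -> N (x * a) = N (y * a).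
  by rewrite mulrBl linearB /= => /subr0_eq.
have F x y : N ((x + y) * a) = 0 -> N (y * a) = - N (x * a).
  by rewrite mulrDl linearD /= addrC => /eqP; rewrite addr_eq0 => /eqP.
case: (ord2P c) => ->; case: (ord2P d) => ->; rewrite ?rev_ord2 /=.
- rewrite expr0 scale1r; apply/esym/E/quot_pi_Rspan.
  by rewrite /ent /= !inord_ord4 !inE eqxx ?orbT.
- rewrite expr1 scaleN1r; apply/F/quot_pi_Rspan.
  by rewrite /ent /= !inord_ord4 !inE eqxx ?orbT.
- rewrite expr1 scaleN1r; apply/F/quot_pi_Rspan.
  by rewrite /ent /= !inord_ord4 !inE eqxx ?orbT.
- rewrite expr2 mulrNN mulr1 scale1r; apply/esym/E/quot_pi_Rspan.
  by rewrite /ent /= !inord_ord4 !inE eqxx ?orbT.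
Qed.

Local Notation o0 := (lshift 2 (ord0 : 'I_2)).
Local Notation o1 := (lshift 2 (ord_max : 'I_2)).

Definition block_det : U := t o0 o0 * t o1 o1 - q *: (t o0 o1 * t o1 o0).

Lemma quot_pi_det a : N (block_det * a) = N a.
Proof.
apply/subr0_eq; rewrite -linearB -[X in _ - X]mul1r -mulrBl; apply: quot_pi_Rspan.
by rewrite /ent /= !inord_ord4 /block_det !inE eqxx !orbT.
Qed.

Let tCol (i j k : 'I_4) : (i < j)%N -> t i k * t j k = q *: (t j k * t i k).
Proof. by move=> ij; apply/subr0_eq/t_rel/QrelCol. Qed.

Let tRow (i j k : 'I_4) : (i < j)%N -> t k i * t k j = q *: (t k j * t k i).
Proof. by move=> ij; apply/subr0_eq/t_rel/QrelRow. Qed.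

Let tComm (i j k l : 'I_4) : (i < j)%N -> (k < l)%N ->
  t i l * t j k = t j k * t i l.
Proof. by move=> ij kl; apply/subr0_eq/t_rel/QrelComm. Qed.

Let tCross (i j k l : 'I_4) : (i < j)%N -> (k < l)%N ->
  t i k * t j l = t j l * t i k + (q - q^-1) *: (t j k * t i l).
Proof.
move=> ij kl; rewrite addrC; apply/eqP; rewrite -subr_eq.
by apply/eqP/subr0_eq/t_rel/QrelCross.
Qed.

(* Moving an upper left generator past t_ij only produces terms that begin with a
   generator outside the two diagonal blocks. *)
Lemma off_comm (k l i j : 'I_4) : (k < 2)%N -> (l < 2)%N -> off_block i j ->
  exists c d i' j' x, off_block i' j' /\
    t k l * t i j = c *: (t i j * t k l) + d *: (t i' j' * x).
Proof.
move=> k2 l2 ij.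
have triv c : t k l * t i j = c *: (t i j * t k l) -> exists c d i' j' x,
    off_block i' j' /\ t k l * t i j = c *: (t i j * t k l) + d *: (t i' j' * x).
  by move=> e; exists c, 0, i, j, 0; rewrite mulr0 scaler0 addr0.
have [[i2 j2]|[i2 j2]] : ((i < 2)%N /\ (2 <= j)%N) \/ ((2 <= i)%N /\ (j < 2)%N).
  by move: ij; rewrite /off_block [(2 <= j)%N]leqNgt [(2 <= i)%N]leqNgt;
    case: (i < 2)%N; case: (j < 2)%N => //; [left|right].
- have lj : (l < j)%N by exact: leq_trans j2.
  have [ki|ki|/val_inj e] := ltngtP k i; last by subst k; apply: (triv q); exact: tRow.
    exists 1, (q - q^-1), k, j, (t i l); split.
      by rewrite /off_block k2 ltnNge j2.
    (* The cross relation yields t_il t_kj, with the block generator first; the two factors commute,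
       which brings the off-block one to the front. *)
    by rewrite scale1r tCross // [in RHS](tComm ki lj).
  by apply: (triv 1); rewrite scale1r [RHS](tComm ki lj).
have ki : (k < i)%N by exact: leq_trans i2.
have [lj|lj|/val_inj e] := ltngtP l j; last by subst l; apply: (triv q); exact: tCol.
  exists 1, (q - q^-1), i, l, (t k j); split.
    by rewrite /off_block l2 ltnNge i2.
  by rewrite scale1r tCross.
by apply: (triv 1); rewrite scale1r [LHS](tComm ki lj).
Qed.

Local Notation B := (free_eval (fun p : 'I_2 * 'I_2 => block p.1 p.2)).

(** Induction on words: by [off_comm], the last letter can be passed at the cost of a term with
    another off-block generator, and both terms vanish by induction. The indices [i], [j] are kept
    general because the new generator may have different ones. *)
Lemma quot_pi_block_off p i j : off_block i j -> N (B p * t i j) = 0.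
Proof.
elim/(@free_ind C): p i j => [|a x y IHx IHy|x [k l] IH] i j ij.
- by rewrite free_eval1 mul1r -[t i j]mulr1; exact: quot_pi_off.
- rewrite free_eval_linear mulrDl -scalerAl linearP /= IHx // IHy //.
  by rewrite scaler0 addr0.
rewrite free_eval_mulgen -mulrA /=.
have [c [d [i' [j' [z [ij' ->]]]]]] :=
  off_comm (ltn_ord k : (lshift 2 k < 2)%N) (ltn_ord l : (lshift 2 l < 2)%N) ij.
have e1 y := quot_pi_mulr y (IH _ _ ij); have e2 y := quot_pi_mulr y (IH _ _ ij').
by rewrite mulrDr -!scalerAr !mulrA linearD !linearZ /= e1 e2 !scaler0 addr0.
Qed.

(** Moving the lower right generator left past a letter of [p] creates a cross term with an
    off-block generator, which vanishes by [quot_pi_block_off]. At the front, [quot_pi_rr]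
    applies. *)
Lemma quot_pi_block_rr p (c d : 'I_2) :
  N (B p * t (rshift 2 c) (rshift 2 d)) =
  (-1) ^+ (c + d) *: N (block (rev_ord c) (rev_ord d) * B p).
Proof.
elim/(@free_ind C): p => [|a x y IHx IHy|x [k l] IH].
- by rewrite free_eval1 mul1r -[t _ _ in LHS]mulr1 quot_pi_rr.
- rewrite free_eval_linear mulrDl mulrDr -scalerAl -scalerAr !linearP /= IHx IHy.
  by rewrite !scalerA mulrC.
rewrite free_eval_mulgen -mulrA /= tCross; last 2 first.
- by rewrite /= (leq_trans (ltn_ord k)) ?leq_addr.
- by rewrite /= (leq_trans (ltn_ord l)) ?leq_addr.
rewrite mulrDr -scalerAr linearD linearZ /= !mulrA.
rewrite [X in _ + _ *: X]quot_pi_mulr ?scaler0 ?addr0; last first.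
  by apply: quot_pi_block_off; rewrite /off_block /= ltn_ord.
rewrite -linearZ scalerAl; apply: quot_pi_mulr_eq.
by rewrite IH linearZ.
Qed.

End BlockReduction.

(** * Centrality of the 2 by 2 quantum determinant *)

Section QuantumDeterminant2.
Context {C : numClosedFieldType} (q : C) (q0 : q != 0) (A : algType C).
Context (w : 'I_2 -> 'I_2 -> A) (w_rel : forall r, qmatrix_rel q w r -> r = 0).

Lemma qdet2_central i j :
  (w ord0 ord0 * w ord_max ord_max - q *: (w ord0 ord_max * w ord_max ord0))
    * w i j =
  w i j *
  (w ord0 ord0 * w ord_max ord_max - q *: (w ord0 ord_max * w ord_max ord0)).
Proof.
have lt01 : ((ord0 : 'I_2) < (ord_max : 'I_2))%N by [].
set a := w ord0 ord0; set b := w ord0 ord_max.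
set c := w ord_max ord0; set d := w ord_max ord_max.
have ac : a * c = q *: (c * a) by apply/subr0_eq/w_rel/QrelCol.
have bd : b * d = q *: (d * b) by apply/subr0_eq/w_rel/QrelCol.
have ab : a * b = q *: (b * a) by apply/subr0_eq/w_rel/QrelRow.
have cd : c * d = q *: (d * c) by apply/subr0_eq/w_rel/QrelRow.
have bc : b * c = c * b by apply/subr0_eq/w_rel/QrelComm.
(* A second expression for the determinant. For the diagonal entries a and d it is used on one side
   only, so that the leading terms a d a or d a d agree. *)
have ad : a * d - q *: (b * c) = d * a - q^-1 *: (b * c).
  have /subr0_eq := w_rel (QrelCross q w lt01 lt01).
  rewrite -/a -/b -/c -/d -bc scalerBl => e; apply/eqP; rewrite subr_eq.
  by rewrite -[_ + _]addrA [- _ + _]addrC -e addrC subrK.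
have db : d * b = q^-1 *: (b * d) by rewrite bd scalerA mulVf // scale1r.
have dc : d * c = q^-1 *: (c * d) by rewrite cd scalerA mulVf // scale1r.
case: (ord2P i) => ->; case: (ord2P j) => ->; rewrite -/a -/b -/c -/d.
- rewrite {2}ad mulrBl mulrBr -scalerAl -scalerAr !mulrA; congr (_ - _).
  rewrite ab -!scalerAl -(mulrA b a) ac -scalerAr !scalerA !mulrA.
  by rewrite mulVf // mul1r.
- rewrite mulrBl mulrBr -scalerAl -scalerAr -!mulrA -bc; congr (_ - _).
  by rewrite db -scalerAr mulrA ab -scalerAl scalerA mulVf // scale1r mulrA.
- rewrite mulrBl mulrBr -scalerAl -scalerAr !mulrA -bc; congr (_ - _).
  by rewrite -(mulrA a d) dc -scalerAr mulrA ac -scalerAl scalerA mulVf // scale1r.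
- rewrite {1}ad mulrBl mulrBr -scalerAl -scalerAr !mulrA; congr (_ - _).
  rewrite -(mulrA b) cd -scalerAr mulrA bd -!scalerAl !scalerA.
  by rewrite mulVf // mul1r.
Qed.

End QuantumDeterminant2.

(** The relations are conditioned only on strict inequalities between indices, so an increasing map
    of indices preserves them; it is applied to the inclusion of the upper left block. *)
Lemma qmatrix_rel_mono (C : numClosedFieldType) (q : C) (A : algType C)
    (m n : nat) (f : 'I_m -> 'I_n) (t : 'I_n -> 'I_n -> A) (r : A) :
  (forall i j : 'I_m, (i < j)%N -> (f i < f j)%N) ->
  qmatrix_rel q (fun i j => t (f i) (f j)) r -> qmatrix_rel q t r.
Proof.
move=> fm; case=> *.
- by apply: QrelCol; exact: fm.
- by apply: QrelRow; exact: fm.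
- by apply: QrelComm; exact: fm.
- by apply: QrelCross; exact: fm.
Qed.

Lemma free_eval_qmatrix_rel (C : numClosedFieldType) (q : C) (A : algType C)
    (I : choiceType) (g : I -> A) n (f : 'I_n -> 'I_n -> I) :
  (forall r, qmatrix_rel q (fun i j => g (f i j)) r -> r = 0) ->
  forall r, qmatrix_rel q (fun i j => free_gen (f i j)) r -> free_eval g r = 0.
Proof.
move=> g_rel r; case=> [i j k ij|i j k ij|i j k l ij kl|i j k l ij kl].
- rewrite free_eval_quad2; apply: g_rel.
  exact: (QrelCol q (fun i j => g (f i j))).
- rewrite free_eval_quad2; apply: g_rel.
  exact: (QrelRow q (fun i j => g (f i j))).
- apply: etrans (linearB _ _ _) _; apply/eqP; rewrite subr_eq0; apply/eqP.
  apply: etrans (free_eval_gen2 _ _ _) _; apply/esym.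
  apply: etrans (free_eval_gen2 _ _ _) _; apply/esym/subr0_eq/g_rel.
  exact: (QrelComm q (fun i j => g (f i j))).
- rewrite free_eval_quad3; apply: g_rel.
  exact: (QrelCross q (fun i j => g (f i j))).
Qed.

(** * Kernel and image of the comparison map *)

Section Kernel.
Context {C : numClosedFieldType} (q : C) (q0 : q != 0).
Context (U : algType C) (HU : hopf_star U).
Context (t : 'I_4 -> 'I_4 -> U) (Dinv : U) (hU : is_Uq q HU t Dinv).
Context (SU : algType C) (HSU : hopf_star SU).
Context (u : 'I_2 -> 'I_2 -> SU) (hSU : is_SUq2 q HSU u).
Context (phi : {linear U -> SU}) (phi1 : phi 1 = 1).
Hypothesis phiM : forall x i, phi (x * Uq_gen t Dinv i) = qstep u i (phi x).

Local Notation RI := (right_ideal (Rspan q t)).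
Local Notation N := (quot_pi RI).
Local Notation block := (fun p : 'I_2 * 'I_2 => t (lshift 2 p.1) (lshift 2 p.2)).
Local Notation B := (free_eval block).
Local Notation D := (qdet q t).
Local Notation phit := (comparison_mul_t phiM).

Let t_rel := Uq_qmatrix0 hU.

(** Upper left generators act by right multiplication, so on block words the orbit of 1 is plain
    evaluation. *)
Lemma comparison_block p : phi (B p) = free_eval (fun p => u p.1 p.2) p.
Proof.
elim/(@free_ind C): p => [|a x y IHx IHy|x [k l] IH].
- by rewrite !free_eval1.
- by rewrite !free_eval_linear linearP IHx IHy.
- by rewrite !free_eval_mulgen /= phit qstep_ll IH.
Qed.

Lemma block_rel r : qmatrix_rel q (fun i j => block (i, j)) r -> r = 0.
Proof. by move=> h; apply: t_rel; apply: (qmatrix_rel_mono _ h). Qed.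

Lemma block_det_comm p : block_det q t * B p = B p * block_det q t.
Proof.
elim/(@free_ind C): p => [|a x y IHx IHy|x [k l] IH].
- by rewrite free_eval1 mulr1 mul1r.
- rewrite free_eval_linear [LHS]mulrDr [RHS]mulrDl -scalerAr -scalerAl.
  by rewrite IHx IHy.
- rewrite free_eval_mulgen mulrA IH -!mulrA; congr (_ * _).
  exact: (qdet2_central q0 block_rel k l).
Qed.

(** By the presentation of SU_q(2), [p] is a combination of products a r b with r a relation.
    Quadratic relations already hold in [U]. For the determinant relation, the block determinant is
    moved past a to the front, where it may be replaced by 1. *)
Lemma block_comparison_ker p : phi (B p) = 0 -> N (B p) = 0.
Proof.
rewrite comparison_block => /(SUq2_presented hSU).2.
elim/span_ind => [|c x y [a [r [b [rX ->]]]] IH]; first by rewrite !linear0.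
rewrite free_eval_linear linearP /= IH addr0.
suff -> : N (B (a * r * b)) = 0 by rewrite scaler0.
rewrite !free_evalM; case: rX => [{}r rr|].
  by rewrite (free_eval_qmatrix_rel block_rel rr) mulr0 mul0r linear0.
rewrite /ent /= !inord_ord2.
have -> : B (free_gen (ord0, ord0) * free_gen (ord_max, ord_max)
    - q *: (free_gen (ord0, ord_max) * free_gen (ord_max, ord0)) - 1) =
    block_det q t - 1.
  apply: etrans (linearB _ _ _) _; congr (_ - _); first exact: free_eval_quad2.
  exact: free_eval1.
rewrite mulrBr mulr1 -block_det_comm mulrBl -mulrA linearB /= quot_pi_det.
exact: subrr.
Qed.

Lemma comparison_mulr_eq0 x a : phi x = 0 -> phi (x * a) = 0.
Proof.
move=> x0; elim/(presented_ind (Uq_presented hU)): a => [|c y z IHy IHz|y i IH].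
- by rewrite mulr1.
- by rewrite mulrDr -scalerAr linearP IHy IHz scaler0 addr0.
- by rewrite mulrA phiM IH linear0.
Qed.

Lemma comparison_Rspan r : Rspan q t r -> phi r = 0.
Proof.
have phi_t i j : phi (t i j) = qstep u (Some (i, j)) 1.
  by rewrite -[t i j]mul1r phit phi1.
elim/span_ind => [|c x y xR IH]; first exact: linear0.
rewrite linearP IH addr0; suff -> : phi x = 0 by rewrite scaler0.
move: xR; rewrite /= /ent /= !inord_ord4 !inE.
do !case/orP; move/eqP->; rewrite ?linearB ?linearD ?linearZ /= ?phit !phi_t
  ?(qstep_lr, qstep_rl) // ?qstep_ll ?qstep_rr ?rev_ord2 /= ?mul1r ?mulr1.
(* The eight off-block generators are already closed; the five remaining ones follow in the order of
   the list. *)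
- by rewrite expr2 mulrNN mulr1 scale1r subrr.
- by rewrite expr1 scaleN1r subrr.
- by rewrite expr1 scaleN1r subrr.
- by rewrite expr0 scale1r subrr.
- by rewrite scalerN phi1 (SUq2_qdet1 hSU) subrr.
Qed.

Lemma comparison_quot x y : N x = N y -> phi x = phi y.
Proof.
move=> /quot_piP xy; apply/subr0_eq; rewrite -linearB.
elim/span_ind: xy => [|c r z rR IH]; first exact: linear0.
rewrite linearP IH addr0; suff -> : phi r = 0 by rewrite scaler0.
elim/span_ind: rR => [|d s w [s' [a [sR ->]]] IHs]; first exact: linear0.
rewrite linearP IHs addr0; suff -> : phi (s' * a) = 0 by rewrite scaler0.
by apply: comparison_mulr_eq0; exact: comparison_Rspan.
Qed.

Lemma block_mul_t p i j : exists p', N (B p * t i j) = N (B p').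
Proof.
case: (@split_ordP 2 2 i) => a ->; case: (@split_ordP 2 2 j) => b ->.
- by exists (p * free_gen (a, b)); rewrite free_eval_mulgen.
- exists 0; rewrite linear0 linear0; apply: (quot_pi_block_off t_rel).
  by rewrite /off_block /= ltn_ord.
- exists 0; rewrite linear0 linear0; apply: (quot_pi_block_off t_rel).
  by rewrite /off_block /= ltn_ord.
(* A lower right generator travels to the front of the word and is replaced there by an upper left
   one. *)
exists ((-1) ^+ (a + b) *: (free_gen (rev_ord a, rev_ord b) * p)).
rewrite (quot_pi_block_rr t_rel).
have -> : B ((-1) ^+ (a + b) *: (free_gen (rev_ord a, rev_ord b) * p)) =
    (-1) ^+ (a + b) *: (block (rev_ord a, rev_ord b) * B p).
  apply: etrans (linearZ_LR _ _ _) _; congr (_ *: _).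
  by apply: etrans (free_evalM _ _ _) _; rewrite free_eval_gen.
by rewrite linearZ.
Qed.

(** Preparation for D_q^-1: each term of D_q is a word of length four, absorbed one letter at a time
    by [block_mul_t]. *)
Lemma block_mul_qdet p : exists p', N (B p * D) = N (B p').
Proof.
rewrite /qdet; elim/big_ind: _ => [|x y [px ex] [py ey]|s _].
- by exists 0; rewrite mulr0 linear0 linear0.
- exists (px + py); rewrite mulrDr linearD /= ex ey -linearD /=.
  by congr (N _); apply/esym; exact: linearD.
have [p1 e1] := block_mul_t p (s (Ordinal (isT : 0 < 4)%N)) (Ordinal (isT : 0 < 4)%N).
have [p2 e2] := block_mul_t p1 (s (Ordinal (isT : 1 < 4)%N)) (Ordinal (isT : 1 < 4)%N).
have [p3 e3] := block_mul_t p2 (s (Ordinal (isT : 2 < 4)%N)) (Ordinal (isT : 2 < 4)%N).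
have [p4 e4] := block_mul_t p3 (s (Ordinal (isT : 3 < 4)%N)) (Ordinal (isT : 3 < 4)%N).
exists ((- q) ^+ perm_length s *: p4).
have -> : B ((- q) ^+ perm_length s *: p4) = (- q) ^+ perm_length s *: B p4.
  exact: linearZ_LR.
rewrite -scalerAr !linearZ /=; congr (_ *: _).
rewrite big_ord4 !mulrA -e4; apply: quot_pi_mulr_eq.
rewrite -e3; apply: quot_pi_mulr_eq; rewrite -e2; apply: quot_pi_mulr_eq.
by rewrite -e1.
Qed.

(** Right multiplication by t_ij is absorbed by [block_mul_t]. For D_q^-1 it suffices that right
    multiplication by D_q fixes the class of a block element; multiplying this congruence by D_q^-1
    on the right gives the claim. *)
Lemma block_span x : exists p, N x = N (B p).
Proof.
elim/(presented_ind (Uq_presented hU)): x => [|c x y [p ep] [r er]|x [[i j]|] [p ep]].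
- by exists 1; rewrite free_eval1.
- by exists (c *: p + r); rewrite free_eval_linear !linearP /= ep er.
- have [p' e] := block_mul_t p i j; exists p'; rewrite -e.
  exact: quot_pi_mulr_eq.
exists p; rewrite /= (quot_pi_mulr_eq _ ep).
have [p' e] := block_mul_qdet p.
(* phi (b * D) = phi b, and phi separates the classes of block elements. *)
have {}e : N (B p * D) = N (B p).
  rewrite e; apply/subr0_eq; rewrite -linearB.
  have EB : B (p' - p) = B p' - B p by exact: linearB.
  rewrite /= -EB; apply: block_comparison_ker; rewrite EB linearB /=.
  by rewrite -(comparison_quot e) (comparison_mul_qdet hU phiM) subrr.
by rewrite -(quot_pi_mulr_eq Dinv e) -mulrA (qdet_mulV hU) mulr1.
Qed.

(** A block representative reduces the nontrivial inclusion to [block_comparison_ker]. *)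
Lemma comparison_ker x : phi x = 0 <-> span RI x.
Proof.
split=> [x0|/quot_pi0P e]; last first.
  by rewrite -(linear0 phi); apply: comparison_quot; rewrite e linear0.
apply/quot_pi0P; have [p e] := block_span x; rewrite e.
by apply: block_comparison_ker; rewrite -(comparison_quot e).
Qed.

Lemma comparison_surj w : exists x, phi x = w.
Proof.
by have [p <-] := (SUq2_presented hSU).1 w; exists (B p); exact: comparison_block.
Qed.

End Kernel.

Local Open Scope complex_scope.

Theorem proposition4 (R : realType) (q : R) (hq : q != 0)
    (U : algType R[i]) (HU : hopf_star U)
    (t : 'I_4 -> 'I_4 -> U) (Dinv : U) (hU : is_Uq q%:C HU t Dinv)
    (SU : algType R[i]) (HSU : hopf_star SU)
    (u : 'I_2 -> 'I_2 -> SU) (hSU : is_SUq2 q%:C HSU u) :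
  exists cQ : tau_coalgebra (quot (right_ideal (Rspan q%:C t))),
    tau_coalg_morphism (hopf_tau HU) cQ
      (quot_pi (right_ideal (Rspan q%:C t))) /\
    tau_coalg_iso cQ (hopf_tau HSU).
Proof.
have q0 : q%:C != 0.
  by rewrite fmorph_eq0.
have [phi [phi1 phiM]] := comparison_map hU hSU.
apply: (@tau_coalgebra_quot _ _ _ (hopf_tau HU) (hopf_tau HSU) phi).
- split.
  + exact: (comparison_comul hU hSU phi1 phiM).
  + exact: (comparison_counit hU hSU phi1 phiM).
  + exact: (comparison_tau hU hSU phi1 phiM).
- exact: (comparison_surj hSU phi1 phiM).
- exact: (comparison_ker q0 hU hSU phi1 phiM).
Qed.
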